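(* Let $\psi\in C[-1,1]$ satisfy $\widehat\psi(0)=1$ and $\sum_{\ell=1}^\infty \ell\,|\widehat\psi(\ell)|<\infty$, and let $\Psi^{\mathrm{div}},\Psi^{\mathrm{curl}}:\mathbb S^2\times\mathbb S^2\to\mathbb R^{3\times3}$ be the matrix-valued kernels built from $\psi$ as in the context. Then for all $(x,y)\in\mathbb S^2\times\mathbb S^2$ $$\Psi^{\mathrm{div}}(x,y)=\sum_{\ell=1}^\infty\widehat\psi(\ell)\sum_{k=1}^{2\ell+1}\mathbf y_{\ell,k}(x)\,\mathbf y_{\ell,k}(y)^\top,\qquad \Psi^{\mathrm{curl}}(x,y)=\sum_{\ell=1}^\infty\widehat\psi(\ell)\sum_{k=1}^{2\ell+1}\mathbf z_{\ell,k}(x)\,\mathbf z_{\ell,k}(y)^\top,$$ and the two series (over $\ell$) of matrix-valued functions converge absolutely and uniformly on $\mathbb S^2\times\mathbb S^2$.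
   Context: $\mathbb S^2$ is the unit sphere in $\mathbb R^3$ with (unnormalized) surface measure $\mu$, $\mu(\mathbb S^2)=4\pi$. For $\ell\ge0$, $\{Y_{\ell,k}\}_{k=1}^{2\ell+1}$ is a real orthonormal basis (in $L_2(\mathbb S^2)$) of the spherical harmonics of degree $\ell$. The surface gradient and surface curl of a smooth scalar function $f$ are $\nabla_*f(x)=(\mathbf I-xx^\top)\nabla f(x)$ and $\mathbf L_*f(x)=x\times\nabla f(x)$ (for any smooth extension of $f$). For $\ell\ge1$, $1\le k\le 2\ell+1$, the vector spherical harmonics are $\mathbf y_{\ell,k}=\mathbf L_*Y_{\ell,k}/\sqrt{\ell(\ell+1)}$ and $\mathbf z_{\ell,k}=\nabla_*Y_{\ell,k}/\sqrt{\ell(\ell+1)}$, regarded as column vectors. For $\psi\in C[-1,1]$ its Fourier–Legendre coefficients are $\widehat\psi(\ell)=2\pi\int_{-1}^1\psi(t)P_\ell(t)\,dt$, with $P_\ell$ the Legendre polynomial normalized by $P_\ell(1)=1$, so that formally $\psi(x\cdot y)=\sum_{\ell\ge0}\frac{2\ell+1}{4\pi}\widehat\psi(\ell)P_\ell(x\cdot y)$. Given $\psi$ with $\widehat\psi(0)=1$, define $$\kappa(t)=\frac1{4\pi(1-t^2)}\int_{-1}^t\bigl(1-4\pi\psi(s)\bigr)\,ds,\qquad t\in(-1,1),$$ extended continuously to $[-1,1]$. With $t=x\cdot y$, $$\Psi^{\mathrm{div}}(x,y)=\kappa'(t)\mathbf Q(x,y)+\kappa(t)\mathbf R(x,y),\qquad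 \Psi^{\mathrm{curl}}(x,y)=\kappa'(t)\mathbf V(x,y)+\kappa(t)\mathbf W(x,y),$$ where $\mathbf Q(x,y)=-(x\times y)(x\times y)^\top$, $\mathbf R(x,y)=t\mathbf I-yx^\top$, $\mathbf V(x,y)=(y-tx)(x-ty)^\top$, $\mathbf W(x,y)=(\mathbf I-xx^\top)(\mathbf I-yy^\top)$. At points with $x=\pm y$ the kernels are understood as the continuous extensions (limits) of these formulas from $x\neq\pm y$. *)

(* Defs.v *)
From mathcomp Require Import all_boot all_order all_algebra.
From mathcomp Require Import all_classical all_reals all_analysis.
(* The notations of multinomials clash with those of mathcomp-analysis. *)
From mathcomp Require Import -(notations) mpoly.

Set Implicit Arguments.
Unset Strict Implicit.
Unset Printing Implicit Defensive.

Import Order.TTheory GRing.Theory Num.Theory numFieldNormedType.Exports.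

Local Open Scope classical_set_scope.
Local Open Scope ring_scope.

Section Vectors.
Variable R : realType.
Implicit Types x y : 'cV[R]_3.

Definition dotv x y : R := \sum_i x i 0 * y i 0.

(* Indices are taken in 'I_3, that is, modulo 3. *)
Definition crossv x y : 'cV[R]_3 :=
  \col_(i < 3) (x (i + 1) 0 * y (i + 2) 0 - x (i + 2) 0 * y (i + 1) 0).

Definition S2 : set 'cV[R]_3 := [set x | dotv x x = 1].

(* Functions on the sphere are represented by functions on R^3; only their
   values on S2 matter, except in [grad], [surf_grad] and [surf_curl], where
   the values off S2 play the role of the smooth extension. *)
Definition partial (i : 'I_3) (f : 'cV[R]_3 -> R) : 'cV[R]_3 -> R :=
  fun x => 'D_(delta_mx i 0) f x.

Definition grad (f : 'cV[R]_3 -> R) x : 'cV[R]_3 := \col_i partial i f x.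

Definition surf_grad (f : 'cV[R]_3 -> R) x : 'cV[R]_3 :=
  (1%:M - x *m x^T) *m grad f x.

Definition surf_curl (f : 'cV[R]_3 -> R) x : 'cV[R]_3 := crossv x (grad f x).

Fixpoint Ck (n : nat) (U : set 'cV[R]_3) (f : 'cV[R]_3 -> R) : Prop :=
  if n is m.+1 then
    (forall x, U x -> differentiable f x) /\ (forall i, Ck m U (partial i f))
  else forall x, U x -> {for x, continuous f}.

Definition smooth_near_S2 (f : 'cV[R]_3 -> R) : Prop :=
  exists U : set 'cV[R]_3, [/\ open U, S2 `<=` U & forall n, Ck n U f].

Definition sph_point (theta phi : R) : 'cV[R]_3 :=
  \col_(i < 3) [:: sin theta * cos phi; sin theta * sin phi; cos theta]`_i.

(* Integral for the surface measure, sin(theta) d(theta) d(phi) in spherical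
   coordinates. *)
Definition sphere_integral (f : 'cV[R]_3 -> R) : R :=
  \int[lebesgue_measure]_(phi in `[0, 2 * pi])
    \int[lebesgue_measure]_(theta in `[0, pi])
      (f (sph_point theta phi) * sin theta).

Definition L2_dot (f g : 'cV[R]_3 -> R) : R :=
  sphere_integral (fun x => f x * g x).

(* Restriction to S2 of a homogeneous harmonic polynomial of degree l. *)
Definition spherical_harmonic (l : nat) (f : 'cV[R]_3 -> R) : Prop :=
  exists p : mpoly 3 R,
    [/\ p \is ishomog1 l mdeg,
        \sum_(i < 3) mderiv i (mderiv i p) = 0 &
        forall x, S2 x -> f x = meval (fun i => x i 0) p].

Definition orthonormal_basis_harmonics (l : nat)
    (Y : 'I_(2 * l + 1) -> 'cV[R]_3 -> R) : Prop :=
  [/\ forall k, spherical_harmonic l (Y k),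
      forall j k, L2_dot (Y j) (Y k) = (j == k)%:R &
      forall f, spherical_harmonic l f ->
        exists c : 'I_(2 * l + 1) -> R,
          forall x, S2 x -> f x = \sum_k c k * Y k x].

Definition vsh_y (Y : forall l : nat, 'I_(2 * l + 1) -> 'cV[R]_3 -> R)
    (l : nat) (k : 'I_(2 * l + 1)) x : 'cV[R]_3 :=
  (Num.sqrt (l * (l + 1))%:R)^-1 *: surf_curl (Y l k) x.

Definition vsh_z (Y : forall l : nat, 'I_(2 * l + 1) -> 'cV[R]_3 -> R)
    (l : nat) (k : 'I_(2 * l + 1)) x : 'cV[R]_3 :=
  (Num.sqrt (l * (l + 1))%:R)^-1 *: surf_grad (Y l k) x.

End Vectors.

Arguments S2 {R}.

(* Rodrigues' formula; the value at 1 is 1. *)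
Definition legendre (R : realType) (l : nat) : {poly R} :=
  ((2 ^ l * l`!)%:R)^-1 *: (('X ^+ 2 - 1) ^+ l)^`(l).

Definition legendre_coef (R : realType) (psi : R -> R) (l : nat) : R :=
  2 * pi *
  \int[lebesgue_measure]_(t in `[-1, 1]) (psi t * (legendre R l).[t]).

(* F on D, and its limit along D at the other points. *)
Definition cont_ext (T : topologicalType) (V : ptopologicalType)
    (D : set T) (F : T -> V) (p : T) : V :=
  if p \in D then F p else lim (F @ within D (nbhs p)).

Section Kernels.
Variables (R : realType) (psi : R -> R).

Definition kappa : R -> R :=
  cont_ext (`]-1, 1[ : set R)
    (fun t : R => (4 * pi * (1 - t ^+ 2))^-1 *
      \int[lebesgue_measure]_(s in `[-1, t]) (1 - 4 * pi * psi s)).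

Definition matQ (x y : 'cV[R]_3) : 'M[R]_3 :=
  - (crossv x y *m (crossv x y)^T).

Definition matR (x y : 'cV[R]_3) : 'M[R]_3 :=
  (dotv x y)%:M - y *m x^T.

Definition matV (x y : 'cV[R]_3) : 'M[R]_3 :=
  (y - dotv x y *: x) *m (x - dotv x y *: y)^T.

Definition matW (x y : 'cV[R]_3) : 'M[R]_3 :=
  (1%:M - x *m x^T) *m (1%:M - y *m y^T).

Definition generic_pairs : set ('cV[R]_3 * 'cV[R]_3) :=
  [set p | [/\ S2 p.1, S2 p.2, p.1 <> p.2 & p.1 <> - p.2]].

Definition div_formula (p : 'cV[R]_3 * 'cV[R]_3) : 'M[R]_3 :=
  derive1 kappa (dotv p.1 p.2) *: matQ p.1 p.2
  + kappa (dotv p.1 p.2) *: matR p.1 p.2.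

Definition curl_formula (p : 'cV[R]_3 * 'cV[R]_3) : 'M[R]_3 :=
  derive1 kappa (dotv p.1 p.2) *: matV p.1 p.2
  + kappa (dotv p.1 p.2) *: matW p.1 p.2.

Definition Psi_div : 'cV[R]_3 * 'cV[R]_3 -> 'M[R]_3 :=
  cont_ext generic_pairs div_formula.

Definition Psi_curl : 'cV[R]_3 * 'cV[R]_3 -> 'M[R]_3 :=
  cont_ext generic_pairs curl_formula.

Variable Y : forall l : nat, 'I_(2 * l + 1) -> 'cV[R]_3 -> R.

Definition div_term (l : nat) (p : 'cV[R]_3 * 'cV[R]_3) : 'M[R]_3 :=
  legendre_coef psi l *:
  \sum_(k < 2 * l + 1) vsh_y Y k p.1 *m (vsh_y Y k p.2)^T.

Definition curl_term (l : nat) (p : 'cV[R]_3 * 'cV[R]_3) : 'M[R]_3 :=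
  legendre_coef psi l *:
  \sum_(k < 2 * l + 1) vsh_z Y k p.1 *m (vsh_z Y k p.2)^T.

End Kernels.

(* For the series of the a l, l >= 1: absolute convergence at every point of
   D, and uniform convergence on D. *)
Definition abs_unif_cvg (R : realType) (V : normedModType R) (T : choiceType)
    (D : set T) (a : nat -> T -> V) : Prop :=
  (forall p, D p -> cvgn (fun n => \sum_(1 <= l < n) `|a l p|)) /\
  {uniform D, (fun n p => \sum_(1 <= l < n) a l p) @ \oo -->
              (fun p => limn (fun n => \sum_(1 <= l < n) a l p))}.

(* Main.v *)
(* On the unit sphere the Laplacian of a homogeneous polynomial of degree n has
   the same integral as n(n+1) times the polynomial: for monomials this follows
   from recursions for trigonometric integrals. Applied to products of a
   harmonic g of degree l with powers of the linear form x |-> x.y, this gives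
   by induction on the power, through Euler's identity, the reproducing property
   int P_l(x.y) g(x) dx = 4 pi / (2l+1) g(y), hence the addition theorem.
   Differentiating the addition theorem along tangent directions in x and in y
   turns the sums over k of the vector harmonics into
   (2l+1) / (4 pi l(l+1)) (P_l''(t) Q + P_l'(t) R), and likewise with V and W,
   and Cauchy-Schwarz over k bounds the entries, and |P_l| and |P_l'| as well.
   By density of polynomials psi is the sum of its Legendre series; integrating
   with the help of Legendre's equation identifies kappa with the series of the
   P_l' and kappa' with that of the P_l''. The uniform bounds then give the
   values at x = y and x = -y as limits. *)
From HB Require Import structures.
Require Import Defs.
From mathcomp Require Import all_boot all_order all_algebra.
From mathcomp Require Import all_classical all_reals all_analysis.
From mathcomp Require Import ring lra zify.
From mathcomp Require Import -(notations) mpoly.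
Import Order.TTheory GRing.Theory Num.Theory numFieldNormedType.Exports.
Local Open Scope classical_set_scope.
Local Open Scope ring_scope.
Set Implicit Arguments.
Unset Strict Implicit.
Unset Printing Implicit Defensive.

(** The series of kappa' cannot be dominated term by term: P_l''(1) grows like l^4, so near t = 1
    and t = -1 its l-th term may exceed l |a_l| by a factor of order l^2, a_l being the
    Fourier-Legendre coefficient. Only the combinations P_l'' Q + P_l' R and P_l'' V + P_l' W are
    under control, because they are sums over k of products of tangential derivatives: for x = y and
    equal directions the P_l'' part drops out and P_l'(1) = l(l+1)/2 is left. This cancels the
    normalization 1/(l(l+1)), so every entry is at most (2l+1)/(4 pi) |a_l|, which is summable. The
    scalar series for kappa' is therefore treated only pointwise on the open interval, through a
    first-order differential equation for kappa and not by termwise differentiation. The functions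
    [Y l k] are tied to harmonic polynomials on the sphere alone, and their extensions are otherwise
    arbitrary. Hence only derivatives in tangent directions are compared, and the entries of surface
    gradients and curls are written as such derivatives. *)

(** * Legendre polynomials: coefficients, Legendre's equation, values at 1 *)

Section LegendrePolynomials.
Variable R : realType.
Implicit Types l n j : nat.

Local Notation u l := (('X ^+ 2 - 1 : {poly R}) ^+ l).

(** This first-order equation for (X^2 - 1)^l gives, by comparing coefficients, a two-step
    recursion. Both the parity of P_l and Legendre's equation are read off from that recursion. *)
Lemma deriv_sqrX_sub1_exp l :
  ('X ^+ 2 - 1) * (u l)^`() = (u l * 'X) *+ (2 * l).
Proof.
case: l => [|l]; first by rewrite expr0 derivC muln0 mulr0 mulr0n.
rewrite deriv_exp derivB derivXn derivC subr0 /= mulrnA exprS mulrnAr.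
congr (_ *+ _); set w := 'X * 'X^1 - 1.
by rewrite expr1 exprS mulrnAl mulrnAr ['X * _]mulrC mulrA.
Qed.

Lemma coef_sqrX_sub1_exp l n :
  n.+2%:R * (u l)`_n.+2 = (n%:R - (2 * l)%:R) * (u l)`_n.
Proof.
have /(congr1 (fun p : {poly R} => p`_n.+1)) := deriv_sqrX_sub1_exp l.
rewrite mulrBl mul1r coefB coefXnM !coef_deriv coefMn coefMX /=.
case: n => [|n] /=; rewrite ?subSS ?subn1 /= => H; first by lra.
move: H; rewrite subn0 -[X in X - _]mulr_natl -[X in _ - X]mulr_natl.
rewrite -[RHS]mulr_natl mulrBl => <-; ring.
Qed.

Lemma coef_sqrX_sub1_exp_odd l n : odd n -> (u l)`_n = 0.
Proof.
elim/ltn_ind: n => -[|[|n]] // IH o.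
  have /(congr1 (fun p : {poly R} => p`_0)) := deriv_sqrX_sub1_exp l.
  rewrite mulrBl mul1r coefB coefXnM !coef_deriv coefMn coefMX /= mulr1n mul0rn.
  lra.
have nu : n.+2%:R != 0 :> R by rewrite pnatr_eq0.
apply: (mulfI nu); rewrite coef_sqrX_sub1_exp (IH n) ?mulr0 //.
by rewrite /= negbK in o.
Qed.

Lemma coef_legendre l j :
  (legendre R l)`_j = ((2 ^ l * l`!)%:R)^-1 * ((l + j) ^_ l)%:R * (u l)`_(l + j).
Proof.
by rewrite /legendre coefZ coef_derivn -[_ *+ (_ ^_ _)]mulr_natl mulrA.
Qed.

Lemma coef_legendre_odd l j : odd (l + j) -> (legendre R l)`_j = 0.
Proof. by move=> o; rewrite coef_legendre coef_sqrX_sub1_exp_odd ?mulr0. Qed.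

Lemma coef_legendre_gt l j : (l < j)%N -> (legendre R l)`_j = 0.
Proof.
move=> lj; rewrite coef_legendre [(u l)`__]nth_default ?mulr0 //.
rewrite (leq_trans (size_poly_exp_leq _ _)) //.
have -> : size ('X^2 - 1 : {poly R}) = 3.
  by rewrite size_polyDl size_polyXn // size_polyN size_poly1.
by rewrite /= mul2n -addnn ltn_add2l.
Qed.

Lemma size_legendre l : (size (legendre R l) <= l.+1)%N.
Proof. by apply/leq_sizeP => j lj; exact: coef_legendre_gt. Qed.

(** Legendre's equation on coefficients. It is the recursion for (X^2 - 1)^l at index l + j, since
    (j - l)(l + j + 1) = j(j+1) - l(l+1). *)
Lemma coef_legendre_rec l j :
  j.+2%:R * j.+1%:R * (legendre R l)`_j.+2 =
  (j%:R * j.+1%:R - l%:R * l.+1%:R) * (legendre R l)`_j.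
Proof.
(* After multiplication by j! both sides are (l + j + 2)!. *)
have E : ((l + j.+2) ^_ l)%:R * j.+2%:R * j.+1%:R =
   (l + j).+2%:R * (l + j).+1%:R * ((l + j) ^_ l)%:R :> R.
  rewrite -!natrM; congr _%:R; apply/eqP.
  rewrite -(@eqn_pmul2r j`!) ?fact_gt0 //; apply/eqP.
  rewrite -!mulnA -factS -factS -[LHS]/(_ * _)%N.
  have := @ffact_fact (l + j.+2) l; rewrite leq_addr => /(_ isT).
  rewrite addnC addnK => ->.
  have := @ffact_fact (l + j) l; rewrite leq_addr => /(_ isT).
  rewrite {2}addnC addnK => ->.
  by rewrite addSn addSn !factS addnC.
rewrite !coef_legendre.
transitivity (((2 ^ l * l`!)%:R)^-1 * (((l + j.+2) ^_ l)%:R * j.+2%:R * j.+1%:R)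
   * (u l)`_(l + j.+2)); first by ring.
rewrite E !addnS.
transitivity (((2 ^ l * l`!)%:R)^-1 * ((l + j).+1%:R * ((l + j) ^_ l)%:R)
   * ((l + j).+2%:R * (u l)`_((l + j).+2))); first by ring.
rewrite coef_sqrX_sub1_exp; ring.
Qed.

Lemma legendre_ode l :
  (1 - 'X ^+ 2) * (legendre R l)^`()^`() =
  'X * (legendre R l)^`() *+ 2 - legendre R l *+ (l * l.+1).
Proof.
apply/polyP => j.
rewrite mulrBl mul1r !coefB coefXnM !coefMn coefXM !coef_deriv.
have := coef_legendre_rec l j.
case: j => [|[|j]] /=; rewrite ?subSS ?subn0 ?subn1 /= ?coef_deriv -1?[_ *+ (l * _)]mulr_natl natrM.
- lra.
- lra.
- lra.
Qed.

(** The product is the double factorial (2l-1)!!. As (X^2 - 1)^l is monic, the claim reduces to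
    (2l)! = 2^l l! (2l-1)!!. *)
Lemma lead_legendre l :
  (legendre R l)`_l * l`!%:R = (\prod_(i < l) (2 * i + 1))%:R.
Proof.
have ul : (u l)`_(l + l) = 1.
  have m : 'X^2 - 1 \is @monic R.
    by rewrite monicE lead_coefDl ?lead_coefXn // size_polyXn size_polyN size_poly1.
  have s : size ('X^2 - 1 : {poly R}) = 3.
    by rewrite size_polyDl size_polyXn // size_polyN size_poly1.
  have /monicP := monic_exp l m; rewrite lead_coefE.
  have -> // : (size (u l)).-1 = (l + l)%N.
  have u0 : u l != 0 by rewrite monic_neq0 // rpredX.
  by rewrite size_exp s /= mul2n addnn.
have E k : (k + k)`! = (2 ^ k * k`! * \prod_(i < k) (2 * i + 1))%N.
  elim: k => [|k IH]; first by rewrite big_ord0.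
  rewrite addSn addnS !factS IH big_ord_recr /= expnS.
  set A := (2 ^ k)%N; set B := k`!; set C := (\prod_(_ < _) _)%N.
  rewrite addnn -muln2; ring.
have := @ffact_fact (l + l) l; rewrite leq_addr => /(_ isT).
rewrite addnK => El; rewrite coef_legendre ul mulr1 -mulrA -natrM El E [X in _ * X]natrM.
by rewrite mulKf // pnatr_eq0 -lt0n muln_gt0 expn_gt0 fact_gt0.
Qed.

(** Only the term in which all l derivatives fall on the power survives at a. One derivative leaves
    a product of the same shape with exponent l - 1 and a new cofactor, so the induction is over all
    g. *)
Lemma horner_derivn_expXsubC (a : R) (g : {poly R}) l :
  ((('X - a%:P) ^+ l * g)^`(l)).[a] = l`!%:R * g.[a].
Proof.
elim: l g => [|l IH] g; first by rewrite expr0 mul1r fact0 mul1r.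
rewrite derivSn.
have -> : (('X - a%:P) ^+ l.+1 * g)^`() =
    ('X - a%:P) ^+ l * (l.+1%:R *: g + ('X - a%:P) * g^`()).
  rewrite derivM deriv_exp derivXsubC mul1r /= exprS -scaler_nat -scalerAl scalerAr.
  by rewrite mulrDr; congr (_ + _); rewrite mulrCA mulrA.
rewrite IH !hornerE subrr mul0r addr0 factS natrM; ring.
Qed.

Lemma legendre_at1 l : (legendre R l).[1] = 1.
Proof.
have -> : legendre R l =
    ((2 ^ l * l`!)%:R)^-1 *: (('X - 1%:P) ^+ l * ('X + 1) ^+ l)^`(l).
  by rewrite /legendre -exprMn; congr (_ *: (_ ^+ _)^`(_)); rewrite polyC1; ring.
rewrite hornerZ horner_derivn_expXsubC !hornerE.
have c0 : (2 ^ l * l`!)%:R != 0 :> R by rewrite pnatr_eq0 -lt0n muln_gt0 expn_gt0 fact_gt0.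
rewrite /= -mulrA [X in _ * X](_ : _ = (2 ^ l * l`!)%:R) ?mulVf //.
by rewrite natrM natrX mulrC.
Qed.

(** At 1 the factor of P_l'' in Legendre's equation vanishes. This value is the constant in all
    later bounds on derivatives. *)
Lemma deriv_legendre_at1 l : (legendre R l)^`().[1] = (l * l.+1)%:R / 2.
Proof.
have := congr1 (horner ^~ 1) (legendre_ode l).
rewrite !(hornerE, hornerXn) expr1n subrr mul0r !hornerMn legendre_at1 ?mul1r.
by move/esym/eqP; rewrite subr_eq0 => /eqP; lra.
Qed.

End LegendrePolynomials.

(** * Recursions for integrals of powers of sine and cosine *)

Section TrigIntegrals.
Variable R : realType.
Local Notation mu := (@lebesgue_measure R).
Implicit Types (a b : R) (f g F : R -> R).

Lemma continuous_integrable_itvcc a b f :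
  continuous f -> mu.-integrable `[a, b] (EFin \o f).
Proof.
move=> cf; apply: continuous_compact_integrable; first exact: segment_compact.
exact: continuous_subspaceT.
Qed.

Lemma Rintegral_sum_continuous (I : Type) (r : seq I) a b (f : I -> R -> R) :
  (forall i, continuous (f i)) ->
  \int[mu]_(x in `[a, b]) (\sum_(i <- r) f i x) =
  \sum_(i <- r) \int[mu]_(x in `[a, b]) f i x.
Proof.
move=> cf; elim: r => [|i r IH].
  under eq_Rintegral do rewrite big_nil.
  by rewrite Rintegral_cst // mul0r big_nil.
under eq_Rintegral do rewrite big_cons.
rewrite RintegralD //; first by rewrite IH big_cons.
  exact: continuous_integrable_itvcc.
apply: continuous_integrable_itvcc => x; apply: cvg_big => [|j _]; last exact: cf.
  exact: add_continuous.
Qed.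

Lemma Rintegral_derive a b f F :
  (forall x, is_derive x (1 : R) F (f x)) -> continuous f -> a < b ->
  \int[mu]_(x in `[a, b]) f x = F b - F a.
Proof.
move=> dF cf ab; rewrite /Rintegral (@continuous_FTC2 _ f F) //.
- exact: continuous_subspaceT.
- have cF x : {for x, continuous F}.
    by apply: differentiable_continuous; apply/derivable1_diffP; exact: ex_derive.
  by split => //; [apply: cvg_at_right_filter|apply: cvg_at_left_filter]; exact: cF.
- by move=> x _; rewrite derive1E; apply: derive_val.
Qed.



Definition trig_integral a b m n : R :=
  \int[mu]_(x in `[a, b]) (sin x ^+ m * cos x ^+ n).

(** A truncated predecessor of 0 is multiplied by the exponent 0, so the formula covers all
    exponents without cases; the recursions below keep this convention. *)
Lemma is_derive_sinX_cosX m n (x : R) :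
  is_derive x (1 : R) (fun x => sin x ^+ m * cos x ^+ n)
    (m%:R * (sin x ^+ m.-1 * cos x ^+ n.+1)
     - n%:R * (sin x ^+ m.+1 * cos x ^+ n.-1)).
Proof.
have H : is_derive x (1 : R) ((@sin R) ^+ m * (@cos R) ^+ n)
    (m%:R * (sin x ^+ m.-1 * cos x ^+ n.+1)
     - n%:R * (sin x ^+ m.+1 * cos x ^+ n.-1)).
  apply: is_derive_eq.
  rewrite !fctE -![_ *: _]/(_ * _) !exprS; ring.
by rewrite (_ : (fun x => _) = (@sin R) ^+ m * (@cos R) ^+ n) //; apply/funext => y; rewrite !fctE.
Qed.

Lemma continuous_sinX_cosX m n :
  continuous (fun x : R => sin x ^+ m * cos x ^+ n).
Proof.
move=> x; apply: differentiable_continuous; apply/derivable1_diffP.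
by apply: ex_derive; exact: is_derive_sinX_cosX.
Qed.

Lemma trig_integral_split a b m n :
  trig_integral a b m n = trig_integral a b m.+2 n + trig_integral a b m n.+2.
Proof.
rewrite /trig_integral -RintegralD //;
  do 1?[exact/continuous_integrable_itvcc/continuous_sinX_cosX].
apply: eq_Rintegral => x _; rewrite -[LHS]mul1r -(cos2Dsin2 x) !exprS; ring.
Qed.

Lemma trig_integral_parts a b m n : a < b ->
  sin b ^+ m * cos b ^+ n = sin a ^+ m * cos a ^+ n ->
  m%:R * trig_integral a b m.-1 n.+1 = n%:R * trig_integral a b m.+1 n.-1.
Proof.
move=> ab Fab; apply/eqP; rewrite -subr_eq0; apply/eqP.
rewrite /trig_integral -!RintegralZl //;
  do 1?[exact/continuous_integrable_itvcc/continuous_sinX_cosX].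
rewrite -RintegralB //; last 2 first.
- apply: continuous_integrable_itvcc => x.
  by apply: cvgM; [exact: cvg_cst|exact: continuous_sinX_cosX].
- apply: continuous_integrable_itvcc => x.
  by apply: cvgM; [exact: cvg_cst|exact: continuous_sinX_cosX].
rewrite (Rintegral_derive (@is_derive_sinX_cosX m n)) // ?Fab ?subrr //.
move=> x; apply: cvgB; apply: cvgM; by [exact: cvg_cst|exact: continuous_sinX_cosX].
Qed.

(* Both recursions come from integrating the derivatives of
   [sin ^ m * cos ^ n] over an interval at whose endpoints they agree. *)
Lemma trig_integral_rec_cos a b m n : a < b ->
  (forall j, sin b ^+ m.+1 * cos b ^+ j = sin a ^+ m.+1 * cos a ^+ j) ->
  n%:R * n.-1%:R * trig_integral a b m n.-2 = n%:R * (n + m)%:R * trig_integral a b m n.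
Proof.
move=> ab Fab; case: n => [|[|n]] /=; first by rewrite !mul0r.
  have := trig_integral_parts ab (Fab 0); rewrite mul0r => /=/eqP.
  by rewrite mulf_eq0 pnatr_eq0 /= => /eqP ->; rewrite mulr0 !mul0r mulr0.
rewrite (trig_integral_split a b m n).
have /= := trig_integral_parts ab (Fab n.+1); rewrite natrD -!natr1.
set p := trig_integral _ _ _ _; set q := trig_integral _ _ _ _.
move=> /(congr1 ( *%R (n%:R + 2))); lra.
Qed.

Lemma trig_integral_rec_sin a b m n : a < b -> (m == 1%N ->
   cos b ^+ n.+1 = cos a ^+ n.+1) ->
  (forall j, sin b ^+ j.+1 * cos b ^+ n.+1 = sin a ^+ j.+1 * cos a ^+ n.+1) ->
  m%:R * m.-1%:R * trig_integral a b m.-2 n = m%:R * (m + n)%:R * trig_integral a b m n.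
Proof.
move=> ab Fc Fab; case: m Fc => [|[|m]] /= Fc; first by rewrite !mul0r.
  have := trig_integral_parts (m := 0) (n := n.+1) ab.
  rewrite !expr0 !mul1r mul0r => /(_ (Fc isT)) /esym/eqP.
  by rewrite mulf_eq0 pnatr_eq0 /= => /eqP ->; rewrite !mulr0 mul0r.
rewrite (trig_integral_split a b m n).
have /= := trig_integral_parts ab (Fab m); rewrite natrD -!natr1.
set p := trig_integral _ _ _ _; set q := trig_integral _ _ _ _.
move=> /(congr1 ( *%R (m%:R + 2))); lra.
Qed.
End TrigIntegrals.

(** * Integration of polynomials over the sphere *)

Section SphereIntegral.
Variable R : realType.
Local Notation mu := (@lebesgue_measure R).
Implicit Types (p q : mpoly 3 R) (m : multinom 3) (x y : 'cV[R]_3).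

Definition ev p x : R := meval (fun i => x i 0) p.

Definition sph_int p : R := sphere_integral (ev p).

Lemma sph_pointE (theta phi : R) :
  [/\ sph_point theta phi ord0 0 = sin theta * cos phi,
      sph_point theta phi (inord 1) 0 = sin theta * sin phi &
      sph_point theta phi (inord 2) 0 = cos theta].
Proof. by split; rewrite mxE ?inordK. Qed.

(** The Jacobian is absorbed into the power of sin theta, whence the successor in its exponent. Each
    monomial then separates into a longitude and a latitude factor. *)
Lemma ev_sph_point p (theta phi : R) :
  ev p (sph_point theta phi) * sin theta =
  \sum_(m <- msupp p) (mcoeff m p *
     (sin phi ^+ m (inord 1) * cos phi ^+ m ord0)) *
     (sin theta ^+ (m ord0 + m (inord 1)).+1 * cos theta ^+ m (inord 2)).
Proof.
have [E0 E1 E2] := sph_pointE theta phi.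
rewrite /ev mevalE mulr_suml; apply: eq_bigr => m _.
rewrite (_ : \prod_(i < 3) _ = (sin theta * cos phi) ^+ m ord0 *
  (sin theta * sin phi) ^+ m (inord 1) * cos theta ^+ m (inord 2)).
  by rewrite !exprMn exprS exprD; ring.
rewrite !big_ord_recr big_ord0 /= mul1r -E0 -E1 -E2.
have e0 : widen_ord (leqnSn 2) (widen_ord (leqnSn 1) ord_max) = ord0 by apply: val_inj.
have e1 : widen_ord (leqnSn 2) ord_max = inord 1 by apply: val_inj; rewrite /= inordK.
have e2 : ord_max = inord 2 :> 'I_3 by apply: val_inj; rewrite /= inordK.
by rewrite e0 e1 e2.
Qed.

Definition longitude_integral m : R :=
  trig_integral 0 (2 * pi) (m (inord 1)) (m ord0).

Definition latitude_integral m : R :=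
  trig_integral 0 pi (m ord0 + m (inord 1)).+1 (m (inord 2)).

Lemma sph_int_inner p (phi : R) :
  \int[mu]_(theta in `[0, pi]) (ev p (sph_point theta phi) * sin theta) =
  \sum_(m <- msupp p) (mcoeff m p * latitude_integral m) *
     (sin phi ^+ m (inord 1) * cos phi ^+ m ord0).
Proof.
under eq_Rintegral do rewrite ev_sph_point.
rewrite Rintegral_sum_continuous => [|m]; last first.
  by move=> x; apply: cvgM; [exact: cvg_cst|exact: continuous_sinX_cosX].
apply: eq_bigr => m _; rewrite RintegralZl //.
  by rewrite -/(trig_integral _ _ _ _) /latitude_integral; ring.
exact/continuous_integrable_itvcc/continuous_sinX_cosX.
Qed.

Lemma continuous_sph_int_inner p :
  continuous (fun phi => \int[mu]_(theta in `[0, pi]) (ev p (sph_point theta phi) * sin theta)).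
Proof.
rewrite (funext (sph_int_inner p)) => x.
apply: cvg_big => [|m _]; first exact: add_continuous.
by apply: cvgM; [exact: cvg_cst|exact: continuous_sinX_cosX].
Qed.

Lemma continuous_ev_sph_point p phi :
  continuous (fun theta => ev p (sph_point theta phi) * sin theta).
Proof.
rewrite (funext (fun theta => ev_sph_point p theta phi)) => x.
apply: cvg_big => [|m _]; first exact: add_continuous.
by apply: cvgM; [exact: cvg_cst|exact: continuous_sinX_cosX].
Qed.

Lemma sph_int_linear : linear sph_int.
Proof.
move=> c p q; rewrite /sph_int /sphere_integral.
have cE f : continuous f -> continuous (fun x : R => c * f x).
  by move=> cf x; apply: cvgM; [exact: cvg_cst|exact: cf].
have E phi : \int[mu]_(theta in `[0, pi]) (ev (c *: p + q) (sph_point theta phi) * sin theta) =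
   c * (\int[mu]_(theta in `[0, pi]) (ev p (sph_point theta phi) * sin theta)) +
   \int[mu]_(theta in `[0, pi]) (ev q (sph_point theta phi) * sin theta).
  rewrite -RintegralZl //; last exact/continuous_integrable_itvcc/continuous_ev_sph_point.
  rewrite -RintegralD //; last 2 first.
  - exact/continuous_integrable_itvcc/cE/continuous_ev_sph_point.
  - exact/continuous_integrable_itvcc/continuous_ev_sph_point.
  by apply: eq_Rintegral => theta _; rewrite /ev mevalD mevalZ; ring.
under eq_Rintegral do rewrite E.
rewrite RintegralD //; last 2 first.
- exact/continuous_integrable_itvcc/cE/continuous_sph_int_inner.
- exact/continuous_integrable_itvcc/continuous_sph_int_inner.
rewrite RintegralZl //; exact/continuous_integrable_itvcc/continuous_sph_int_inner.
Qed.

HB.instance Definition _ :=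
  GRing.isLinear.Build R (mpoly 3 R) R *%R sph_int sph_int_linear.

Lemma sph_intX m :
  sph_int (mpolyX R m) = longitude_integral m * latitude_integral m.
Proof.
rewrite /sph_int /sphere_integral.
under eq_Rintegral do rewrite sph_int_inner msuppX big_seq1 mcoeffX eqxx mul1r.
rewrite RintegralZl //; first by rewrite mulrC.
exact/continuous_integrable_itvcc/continuous_sinX_cosX.
Qed.

Definition laplacian p : mpoly 3 R := \sum_(i < 3) mderiv i (mderiv i p).

Lemma laplacian_linear : linear laplacian.
Proof.
move=> c p q; rewrite /laplacian scaler_sumr -big_split /=.
by apply: eq_bigr => i _; rewrite !linearP.
Qed.

HB.instance Definition _ :=
  GRing.isLinear.Build R (mpoly 3 R) (mpoly 3 R) *:%R laplacian laplacian_linear.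

(* On a sphere the Laplacian and the Laplace-Beltrami operator differ on
   homogeneous polynomials of degree n by n(n+1), and the latter integrates
   to 0. *)
Lemma sph_int_laplacianX m :
  sph_int (laplacian (mpolyX R m)) = (mdeg m * (mdeg m).+1)%:R * sph_int (mpolyX R m).
Proof.
Proof.
pose i0 : 'I_3 := ord0; pose i1 : 'I_3 := inord 1; pose i2 : 'I_3 := inord 2.
have E (i : 'I_3) : sph_int (mderiv i (mderiv i (mpolyX R m))) =
    (m i)%:R * (m i).-1%:R *
    sph_int (mpolyX R (mnm_sub (mnm_sub m (mnm1 i)) (mnm1 i))).
  by rewrite mderivX mderivZ mderivX !linearZ /= mnmBE mnm1E eqxx subn1 mulrA.
have S (F : 'I_3 -> R) : \sum_(i < 3) F i = F i0 + F i1 + F i2.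
  rewrite !big_ord_recr big_ord0 /= add0r.
  by congr (F _ + F _ + F _); apply: val_inj; rewrite /= ?inordK.
have -> : sph_int (laplacian (mpolyX R m)) =
    \sum_(i < 3) sph_int (mderiv i (mderiv i (mpolyX R m))).
  exact: linear_sum.
rewrite S !E !sph_intX /longitude_integral /latitude_integral.
have D01 : (i0 == i1) = false by apply/eqP => /(congr1 val); rewrite /= inordK.
have D02 : (i0 == i2) = false by apply/eqP => /(congr1 val); rewrite /= inordK.
have D12 : (i1 == i2) = false by apply/eqP => /(congr1 val); rewrite /= !inordK.
rewrite !mnmBE !mnm1E -/i0 -/i1 -/i2 !eqxx ![i1 == i0]eq_sym ![i2 == _]eq_sym D01 D02 D12.
rewrite !subn0 !subn1 (_ : mdeg m = m i0 + m i1 + m i2)%N; last first.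
  by rewrite mdegE !big_ord_recr big_ord0 /= add0n;
     congr (m _ + m _ + m _)%N; apply: val_inj; rewrite /= ?inordK.
move: (m i0) (m i1) (m i2) => a b c {m E}.
have pi0 := pi_gt0 R; have pi20 : (0 : R) < 2 * pi by rewrite mulr_gt0.
have s2 : sin (2 * pi) = 0 :> R by rewrite mulr_natl sin2pi.
have c2 : cos (2 * pi) = 1 :> R by rewrite mulr_natl cos2pi.
have Jcos := @trig_integral_rec_cos R _ _ b a pi20.
have Jsin := @trig_integral_rec_sin R _ _ b a pi20.
have Tcos := @trig_integral_rec_cos R _ _ (a + b).+1 c pi0.
have Tsin := @trig_integral_rec_sin R _ _ (a + b).+1 c pi0.
move: Jcos Jsin Tcos Tsin; rewrite s2 c2 sinpi cospi !sin0 !cos0.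
have Z j k u v : (0 : R) ^+ j.+1 * u ^+ k = 0 ^+ j.+1 * v ^+ k.
  by rewrite !exprS !mul0r.
move=> /(_ (fun=> Z _ _ _ _)) Jcos /(_ (fun=> erefl) (fun=> Z _ _ _ _)) Jsin.
move=> /(_ (fun=> Z _ _ _ _)) Tcos Tsin.
(* The recursion with exponent a + b + 1, divided by a + b + 1 and multiplied by a + b. The factor a
   + b makes it true for a + b = 0 as well, where the recursion itself may fail because cos pi = -1
   while cos 0 = 1. *)
have {}Tsin : ((a + b)%:R) ^+ 2 * trig_integral 0 pi (a + b).-1 c =
    (a + b)%:R * ((a + b).+1 + c)%:R * trig_integral 0 pi (a + b).+1 c :> R.
  case: (posnP (a + b)) => [-> | q0]; first by rewrite expr0n !mul0r.
  have q1 : ((a + b).+1 == 1)%N = false by rewrite eqSS -leqn0 leqNgt q0.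
  move: Tsin; rewrite q1 => /(_ (fun (e : false) => ltac:(done)) (fun=> Z _ _ _ _)) /=.
  rewrite -!mulrA => /mulfI; rewrite pnatr_eq0 => /(_ isT) H.
  by rewrite H.
set J := trig_integral 0 (2 * pi) b a in Jcos Jsin *; clearbody J.
(* The longitude recursion turns a(a-1) into a(a+b). For a = 0 and a = 1 the truncated exponents of
   the latitude factors disagree, but both sides are then 0. With [T2] the sum over a and b carries
   the factor (a+b)^2, which [Tsin] matches. *)
have T1 : a%:R * a.-1%:R * (trig_integral 0 (2 * pi) b a.-2 *
    trig_integral 0 pi (a.-2 + b).+1 c) =
    a%:R * (a + b)%:R * J * trig_integral 0 pi (a + b).-1 c.
  rewrite mulrA Jcos; case: a {Jsin Tcos Tsin} Jcos => [|[|a]] /=;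
    by [rewrite !mul0r|rewrite mulr0 !mul0r => <-; rewrite !mul0r|rewrite addSn].
have T2 : b%:R * b.-1%:R * (trig_integral 0 (2 * pi) b.-2 a *
    trig_integral 0 pi (a + b.-2).+1 c) =
    b%:R * (b + a)%:R * J * trig_integral 0 pi (a + b).-1 c.
  rewrite mulrA Jsin; case: b {Jcos T1 Tcos Tsin} Jsin => [|[|b]] /=;
    by [rewrite !mul0r|rewrite mulr0 !mul0r => <-; rewrite !mul0r|rewrite !addnS].
rewrite T1 T2 [X in _ + X]mulrCA Tcos.
transitivity (J * ((a + b)%:R ^+ 2 * trig_integral 0 pi (a + b).-1 c) +
  J * (c%:R * (c + (a + b).+1)%:R * trig_integral 0 pi (a + b).+1 c)).
  by rewrite [(b + a)%N]addnC natrD; ring.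
rewrite Tsin natrM -!natr1 !natrD -!natr1 !natrD; ring.
Qed.
Lemma sph_int_laplacian n p : p \is ishomog1 n mdeg ->
  sph_int (laplacian p) = (n * n.+1)%:R * sph_int p.
Proof.
move=> /dhomogP hp; rewrite [p in RHS]mpolyE [p in LHS]mpolyE.
rewrite [laplacian _]linear_sum ![sph_int _]linear_sum mulr_sumr.
apply: eq_big_seq => m /hp /= dm.
rewrite [laplacian _]linearZ ![sph_int _]linearZ /= sph_int_laplacianX -dm; ring.
Qed.

Lemma sph_int1 : sph_int 1 = 4 * pi.
Proof.
rewrite -mpolyX0 sph_intX /longitude_integral /latitude_integral !mnm0E.
have pi0 := pi_gt0 R; have pi20 : (0 : R) < 2 * pi by rewrite mulr_gt0.
rewrite /trig_integral; under eq_Rintegral do rewrite !expr0 mul1r.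
rewrite Rintegral_cst //= lebesgue_measure_itv /= lte_fin pi20 /= oppr0 addr0 mul1r.
have dcos (x : R) : is_derive x (1 : R) (- @cos R) (sin x ^+ 1 * cos x ^+ 0).
  by apply: is_derive_eq; rewrite opprK mulr1.
rewrite (Rintegral_derive dcos) //; last exact: continuous_sinX_cosX.
by rewrite !fctE cospi cos0; ring.
Qed.

End SphereIntegral.

(** * Harmonic polynomials and the reproducing property *)

Section Zonal.
Variable R : realType.
Implicit Types (p q g : mpoly 3 R) (m : multinom 3) (x y : 'cV[R]_3).

Lemma mderiv_exp i p n :
  mderiv i (p ^+ n.+1) = n.+1%:R *: (p ^+ n * mderiv i p).
Proof.
elim: n => [|n IH]; first by rewrite !expr1 expr0 mul1r scale1r.
rewrite exprS mderivM IH [in RHS]exprS -scalerAr mulrA -mulrC addrC.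
by rewrite exprS -[n.+2%:R]natr1 scalerDl scale1r.
Qed.

Lemma laplacianM p q : laplacian (p * q) =
  laplacian p * q + (\sum_(i < 3) mderiv i p * mderiv i q) *+ 2 + p * laplacian q.
Proof.
rewrite /laplacian mulr_suml mulr_sumr -sumrMnl -!big_split /=.
apply: eq_bigr => i _; rewrite mderivM mderivD !mderivM mulr2n !addrA.
by rewrite -!addrA; congr (_ + _); rewrite addrCA addrA.
Qed.

Definition linform y : mpoly 3 R := \sum_(i < 3) y i 0 *: mpolyX R (mnm1 i).

Definition dirderiv y p : mpoly 3 R := \sum_(i < 3) y i 0 *: mderiv i p.

Definition sqnorm : mpoly 3 R := \sum_(i < 3) mpolyX R (mnm1 i) ^+ 2.

Lemma mderiv_var (i j : 'I_3) : mderiv i (mpolyX R (mnm1 j)) = (i == j)%:R.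
Proof.
rewrite mderivX mnm1E eq_sym; case: eqP => [->|]; last by rewrite scale0r.
by rewrite scale1r -mpolyX0; congr mpolyX; apply/mnmP => k; rewrite mnmBE subnn mnm0E.
Qed.

Lemma mderiv_linform i y : mderiv i (linform y) = (y i 0)%:A.
Proof.
rewrite linear_sum (bigD1 i) //= linearZ /= mderiv_var eqxx big1 ?addr0 // => j ji.
by rewrite linearZ /= mderiv_var eq_sym (negPf ji) scaler0.
Qed.

Lemma mderiv_sqnorm i : mderiv i sqnorm = 2 *: mpolyX R (mnm1 i).
Proof.
rewrite linear_sum (bigD1 i) //= mderiv_exp mderiv_var eqxx expr1 mulr1 big1 ?addr0 // => j ji.
by rewrite mderiv_exp mderiv_var eq_sym (negPf ji) mulr0 scaler0.
Qed.

Lemma dotvE x y : dotv x y = \sum_(i < 3) x i 0 * y i 0. Proof. by []. Qed.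

Lemma ev_linform y x : ev (linform y) x = dotv x y.
Proof.
rewrite /ev /linform linear_sum dotvE; apply: eq_bigr => i _.
by rewrite /= mevalZ mevalXU mulrC.
Qed.

Lemma ev_sqnorm x : ev sqnorm x = dotv x x.
Proof.
rewrite /ev linear_sum dotvE; apply: eq_bigr => i _.
by rewrite /= expr2 mevalM mevalXU.
Qed.

Lemma laplacian_linform_exp y n : dotv y y = 1 ->
  laplacian (linform y ^+ n) = (n%:R * n.-1%:R) *: linform y ^+ n.-2.
Proof.
move=> y1; case: n => [|[|n]].
- by rewrite mul0r scale0r /laplacian big1 // => i _; rewrite expr0 mderivC linear0.
- rewrite mulr0 scale0r /laplacian big1 // => i _.
  by rewrite expr1 mderiv_linform linearZ /= mderivC scaler0.
rewrite /laplacian /=; under eq_bigr => i _.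
  rewrite mderiv_exp mderivZ mderiv_linform -scalerAr mulr1 !mderivZ.
  rewrite mderiv_exp mderiv_linform -scalerAr mulr1 !scalerA.
  over.
rewrite -scaler_suml; congr (_ *: _).
transitivity (n.+2%:R * n.+1%:R * dotv y y); last by rewrite y1 mulr1.
by rewrite dotvE mulr_sumr; apply: eq_bigr => i _; ring.
Qed.

Lemma mderiv_linform_exp y i n :
  mderiv i (linform y ^+ n) = (n%:R * y i 0) *: linform y ^+ n.-1.
Proof.
case: n => [|n]; first by rewrite expr0 mderivC mul0r scale0r.
by rewrite mderiv_exp mderiv_linform -scalerAr mulr1 scalerA.
Qed.

Lemma mderiv_sqnorm_exp i n : mderiv i (sqnorm ^+ n) =
  (n%:R * 2) *: (sqnorm ^+ n.-1 * mpolyX R (mnm1 i)).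
Proof.
case: n => [|n]; first by rewrite expr0 mderivC mul0r scale0r.
by rewrite mderiv_exp mderiv_sqnorm -scalerAr scalerA.
Qed.

Lemma laplacian_sqnorm_exp n :
  laplacian (sqnorm ^+ n) = (2 * n * (2 * n + 1))%:R *: sqnorm ^+ n.-1.
Proof.
rewrite /laplacian; under eq_bigr => i _.
  rewrite mderiv_sqnorm_exp mderivZ mderivM mderiv_sqnorm_exp mderiv_var eqxx mulr1.
  rewrite -scalerAl -mulrA -expr2.
  over.
rewrite -scaler_sumr big_split /= -scaler_sumr -mulr_sumr -/sqnorm sumr_const card_ord.
case: n => [|[|n]] /=.
- by rewrite muln0 mul0n !mul0r !scale0r.
- rewrite mul0r scale0r add0r expr0 -[X in _ *: X]scaler_nat scalerA.
  by congr (_ *: _); ring.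
rewrite -exprSr -[_ *+ 3]scaler_nat -scalerDl scalerA; congr (_ *: _).
rewrite !natrM natrD !natrM -!natr1; ring.
Qed.

Lemma laplacian_mul_linform_exp g y n : dotv y y = 1 ->
  laplacian (g * linform y ^+ n) = laplacian g * linform y ^+ n +
   (2 * n%:R) *: (dirderiv y g * linform y ^+ n.-1) +
   (n%:R * n.-1%:R) *: (g * linform y ^+ n.-2).
Proof.
move=> y1; rewrite laplacianM laplacian_linform_exp // -scalerAr; congr (_ + _ + _).
rewrite -scaler_nat -scalerA; congr (_ *: _).
rewrite /dirderiv mulr_suml scaler_sumr; apply: eq_bigr => i _.
by rewrite mderiv_linform_exp -scalerAr -scalerAl scalerA.
Qed.

Lemma euler_identity l g : g \is ishomog1 l mdeg ->
  \sum_(i < 3) mpolyX R (mnm1 i) * mderiv i g = l%:R *: g.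
Proof.
move=> /dhomogP hg; rewrite [g]mpolyE.
under eq_bigr => i _ do rewrite linear_sum mulr_sumr.
rewrite exchange_big scaler_sumr; apply: eq_big_seq => m /hg /= <-.
rewrite mdegE natr_sum scaler_suml; apply: eq_bigr => i _.
rewrite linearZ /= mderivX -!scalerAr -mpolyXD !scalerA.
have [m0|m0] := posnP (m i); first by rewrite m0 mulr0 mul0r !scale0r.
rewrite mulrC; congr (_ *: mpolyX _ _); apply/mnmP => j.
by rewrite mnmDE mnmBE mnm1E; case: eqP => [<-|_]; rewrite ?subnKC // add0n subn0.
Qed.

Lemma ev_dirderiv l g y : g \is ishomog1 l mdeg ->
  ev (dirderiv y g) y = l%:R * ev g y.
Proof.
move=> /euler_identity /(congr1 (fun p => ev p y)).
rewrite /ev mevalZ => <-; rewrite /dirderiv !linear_sum; apply: eq_bigr => i _.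
by rewrite /= mevalZ mevalM mevalXU.
Qed.

Lemma dhomog_mderiv l i g : g \is ishomog1 l.+1 mdeg ->
  mderiv i g \is ishomog1 l mdeg.
Proof.
move=> /dhomogP hg; apply/dhomogP => m; rewrite mcoeff_msupp mcoeff_mderiv => mn0.
have /hg : mnm_add m (mnm1 i) \in msupp g.
  by rewrite mcoeff_msupp; apply: contraNneq mn0 => ->; rewrite mul0rn.
by rewrite /= mdegD mdeg1 addn1 => -[].
Qed.

Lemma dhomog_dirderiv l y g : g \is ishomog1 l.+1 mdeg ->
  dirderiv y g \is ishomog1 l mdeg.
Proof. by move=> hg; apply: rpred_sum => i _; apply/rpredZ/dhomog_mderiv. Qed.

Lemma mderiv_sum i (F : 'I_3 -> mpoly 3 R) :
  mderiv i (\sum_(j < 3) F j) = \sum_(j < 3) mderiv i (F j).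
Proof. exact: linear_sum. Qed.

Lemma laplacian_dirderiv y g : laplacian g = 0 -> laplacian (dirderiv y g) = 0.
Proof.
move=> g0; transitivity (dirderiv y (laplacian g)); last first.
  by rewrite g0 /dirderiv big1 // => i _; rewrite linear0 scaler0.
rewrite /laplacian /dirderiv.
under [RHS]eq_bigr do rewrite mderiv_sum scaler_sumr.
rewrite [RHS]exchange_big; apply: eq_bigr => i _; rewrite !mderiv_sum.
apply: eq_bigr => j _; rewrite !mderivZ.
by rewrite (mderiv_comm j i) (mderiv_comm j i).
Qed.

Lemma dhomog_linform y : linform y \is ishomog1 1 mdeg.
Proof. by apply: rpred_sum => i _; apply: rpredZ; rewrite dhomogX; apply/eqP/mdeg1. Qed.

Lemma dhomog_linform_exp y n : linform y ^+ n \is ishomog1 n mdeg.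
Proof. by have := dhomogMn n (dhomog_linform y); rewrite mul1n. Qed.

Lemma dhomog_sqnorm : sqnorm \is ishomog1 2 mdeg.
Proof.
apply: rpred_sum => i _; rewrite expr2 -mpolyXD dhomogX.
by apply/eqP; rewrite /= mdegD mdeg1.
Qed.

Lemma dhomog0E g : g \is ishomog1 0 mdeg -> g = mpolyC 3 (mcoeff (@mnm0 3) g).
Proof.
move=> hg; apply/mpolyP => m; rewrite mcoeffC.
have [->|m0] := eqVneq m (@mnm0 3); first by rewrite mulr1.
by rewrite mulr0 (dhomog_nemf_coeff hg) //= mdeg_eq0.
Qed.

(** The product is (2l+1)!!. Integrating the Laplacian of g (x.y)^j expresses the integral by one
    with the derivative of g along y, harmonic of degree l - 1, and one with g and power j - 2. The
    first falls under the outer induction on l, with Euler's identity evaluating that derivative at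
    y. The second vanishes by the inner induction on j, its power being less than l. *)
Lemma sph_int_mul_linform_exp l j g y : dotv y y = 1 ->
  g \is ishomog1 l mdeg -> laplacian g = 0 -> (j <= l)%N ->
  sph_int (g * linform y ^+ j) =
  (j == l)%:R * (4 * pi * l`!%:R / (\prod_(i < l) (2 * i + 3))%:R * ev g y).
Proof.
move=> y1; elim: l j g => [|l IHl] j g hg g0.
  rewrite leqn0 => /eqP ->; rewrite expr0 mulr1 eqxx mul1r big_ord0 fact0 divr1 mulr1.
  rewrite (dhomog0E hg) /ev mevalC -[mpolyC _ _]mulr1 mul_mpolyC.
  by rewrite [sph_int _]linearZ /= sph_int1 mulrC.
elim/ltn_ind: j => j IHj jl.
have H : ((l.+1 + j) * (l.+1 + j).+1)%:R * sph_int (g * linform y ^+ j) =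
   2 * j%:R * sph_int (dirderiv y g * linform y ^+ j.-1) +
   j%:R * j.-1%:R * sph_int (g * linform y ^+ j.-2).
  rewrite -sph_int_laplacian; last by apply: dhomogM => //; exact: dhomog_linform_exp.
  rewrite laplacian_mul_linform_exp // g0 mul0r add0r.
  by rewrite [sph_int _]linearD /= ![sph_int (_ *: _)]linearZ.
have c0 : ((l.+1 + j) * (l.+1 + j).+1)%:R != 0 :> R by rewrite pnatr_eq0.
apply: (mulfI c0); rewrite {}H.
have -> : j%:R * j.-1%:R * sph_int (g * linform y ^+ j.-2) = 0.
  case: j IHj jl {c0} => [|[|j]] IHj jl; rewrite ?mul0r ?mulr0 ?mul0r //=.
  rewrite IHj //; last by rewrite ltnW // ltnW.
  by rewrite ltn_eqF ?mul0r ?mulr0 // ltnW.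
case: j IHj jl {c0} => [|j] IHj jl; first by rewrite mulr0 !mul0r addr0 mulr0.
rewrite addr0 /= IHl //; [|exact: dhomog_dirderiv|exact: laplacian_dirderiv].
rewrite eqSS; case: eqP => [->|_]; last by rewrite !mul0r !mulr0.
rewrite (ev_dirderiv _ hg) big_ord_recr /= factS !natrM !mul1r.
set P := (\prod_(i < l) _)%N.
have P0 : P%:R != 0 :> R.
  by rewrite pnatr_eq0 -lt0n; apply: prodn_gt0 => i; rewrite addn_gt0 orbT.
have -> : (l.+1 + l.+1)%:R = 2 * l.+1%:R :> R by rewrite natrD; ring.
have -> : (l.+1 + l.+1).+1%:R = 2 * l%:R + 3 :> R.
  by rewrite -natr1 natrD -natr1; ring.
have -> : (2 * l + 3)%:R = 2 * l%:R + 3 :> R by rewrite natrD natrM.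
have l0 : 2 * l%:R + 3 != 0 :> R by rewrite -natrM -natrD pnatr_eq0 addnC.
by field; rewrite P0 l0.
Qed.

(** The inhomogeneous polynomial with values P_l(x.y) everywhere, suited to integration against a
    harmonic of degree at least l. Its companion [zonal] has the same values on the sphere, but is
    homogeneous and harmonic. *)
Definition legendre_linform l y : mpoly 3 R :=
  \sum_(j < l.+1) (legendre R l)`_j *: linform y ^+ j.

Lemma legendre_sum l t :
  (legendre R l).[t] = \sum_(j < l.+1) (legendre R l)`_j * t ^+ j.
Proof. exact/horner_coef_wide/size_legendre. Qed.

Lemma ev_legendre_linform l x y :
  ev (legendre_linform l y) x = (legendre R l).[dotv x y].
Proof.
rewrite legendre_sum /ev linear_sum; apply: eq_bigr => j _.
by rewrite /= mevalZ rmorphXn /= -/(ev _ _) ev_linform.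
Qed.

(** Powers of x.y below l integrate to 0 against g, so only the leading coefficient of P_l counts.
    Its (2l-1)!! against the (2l+1)!! of the top power leaves the factor 2l + 1. *)
Lemma sph_int_legendre l g y : dotv y y = 1 -> g \is ishomog1 l mdeg ->
  laplacian g = 0 ->
  sph_int (g * legendre_linform l y) = 4 * pi / (2 * l + 1)%:R * ev g y.
Proof.
move=> y1 hg g0; rewrite /legendre_linform mulr_sumr [sph_int _]linear_sum /=.
rewrite big_ord_recr big1 ?add0r => [|j _]; last first.
  rewrite -scalerAr [sph_int _]linearZ /= (sph_int_mul_linform_exp _ hg) //; last exact: ltnW.
  by rewrite ltn_eqF ?mul0r ?mulr0.
rewrite /= -scalerAr [sph_int _]linearZ /= (sph_int_mul_linform_exp _ hg) //.
rewrite eqxx mul1r.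
have P0 : ((\prod_(i < l) (2 * i + 3))%N)%:R != 0 :> R.
  by rewrite pnatr_eq0 -lt0n; apply: prodn_gt0 => i; rewrite addn_gt0 orbT.
have L := lead_legendre R l.
have E : (\prod_(i < l) (2 * i + 1) * (2 * l + 1) = \prod_(i < l) (2 * i + 3))%N.
  elim: l {hg L P0} => [|l IH]; first by rewrite !big_ord0.
  by rewrite big_ord_recr [RHS]big_ord_recr /= IH; congr (_ * _)%N; ring.
have l0 : (2 * l + 1)%:R != 0 :> R by rewrite pnatr_eq0 addn1.
move/(congr1 (fun n => n%:R : R)): E; rewrite natrM -L => E.
rewrite -E in P0 *; move: P0; rewrite mulf_eq0 negb_or => /andP[P0 _].
move: P0; rewrite mulf_eq0 negb_or => /andP[P0 P1].
by rewrite natrD natrM in l0 *; field; rewrite P0 P1 l0.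
Qed.

(* The coefficients of [legendre] of the wrong parity vanish, so the halving
   is exact wherever it matters. *)
Definition zonal l y : mpoly 3 R :=
  \sum_(j < l.+1) (legendre R l)`_j *: (linform y ^+ j * sqnorm ^+ (l - j)./2).

Lemma ev_zonal l x y : S2 x -> ev (zonal l y) x = (legendre R l).[dotv x y].
Proof.
move=> x1; rewrite legendre_sum /ev linear_sum; apply: eq_bigr => j _.
rewrite /= mevalZ mevalM !rmorphXn /= -/(ev _ _) -/(ev _ _) ev_linform ev_sqnorm.
by rewrite x1 expr1n mulr1.
Qed.

Lemma dhomog_zonal l y : zonal l y \is ishomog1 l mdeg.
Proof.
apply: rpred_sum => j _; case o : (odd (l + j)).
  by rewrite coef_legendre_odd // scale0r rpred0.
have jl : (j <= l)%N by rewrite -ltnS.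
have H := dhomogM (dhomog_linform_exp y j) (dhomogMn (l - j)./2 dhomog_sqnorm).
by apply: rpredZ; move: H; rewrite mul2n even_halfK ?subnKC // oddB // -oddD o.
Qed.

Lemma laplacian_linform_sqnorm y a n : dotv y y = 1 ->
  laplacian (linform y ^+ a * sqnorm ^+ n) =
  (a%:R * a.-1%:R) *: (linform y ^+ a.-2 * sqnorm ^+ n) +
  (2 * n * (2 * n + 1 + 2 * a))%:R *: (linform y ^+ a * sqnorm ^+ n.-1).
Proof.
move=> y1; rewrite laplacianM laplacian_linform_exp // laplacian_sqnorm_exp.
rewrite -scalerAl -scalerAr -addrA; congr (_ + _).
have -> : \sum_(i < 3) mderiv i (linform y ^+ a) * mderiv i (sqnorm ^+ n) =
    (a%:R * n%:R * 2) *: (linform y ^+ a * sqnorm ^+ n.-1).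
  set c := a%:R * n%:R * 2.
  transitivity (c *: (linform y ^+ a.-1 * linform y * sqnorm ^+ n.-1)).
    rewrite {3}/linform mulr_sumr mulr_suml scaler_sumr; apply: eq_bigr => i _.
    rewrite mderiv_linform_exp mderiv_sqnorm_exp -!scalerAl -!scalerAr -scalerAl !scalerA.
    congr (_ *: _); first by rewrite /c; ring.
    by rewrite -!mulrA; congr (_ * _); rewrite mulrC.
  rewrite /c; case: a {c} => [|a]; first by rewrite !mul0r !scale0r.
  by rewrite -exprSr.
rewrite -scaler_nat scalerA -scalerDl; congr (_ *: _).
by ring.
Qed.

(** After a shift of the index by 2 in the first sum, the terms in (x.y)^j cancel by
    [coef_legendre_rec]: with 2i + j = l the factor 2i(2i + 1 + 2j) equals l(l+1) - j(j+1). For j of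
    the wrong parity both coefficients are 0. *)
Lemma laplacian_zonal l y : dotv y y = 1 -> laplacian (zonal l y) = 0.
Proof.
move=> y1; rewrite /zonal [laplacian _]linear_sum /=.
under eq_bigr => j _ do rewrite [laplacian _]linearZ /= laplacian_linform_sqnorm // scalerDr !scalerA.
rewrite big_split /=.
pose F j : mpoly 3 R := ((legendre R l)`_j * (j%:R * j.-1%:R)) *:
   (linform y ^+ j.-2 * sqnorm ^+ (l - j)./2).
have -> : \sum_(i < l.+1) ((legendre R l)`_i * (i%:R * i.-1%:R)) *:
     (linform y ^+ i.-2 * sqnorm ^+ (l - i)./2) = \sum_(i < l.+1) F i.+2.
  transitivity (\sum_(i < l.+3) F i).
    rewrite 2![in RHS]big_ord_recr /= /F !coef_legendre_gt // !mul0r !scale0r !addr0.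
    by [].
  rewrite big_ord_recl big_ord_recl /= /F /= mul0r mulr0 scale0r add0r.
  by rewrite mulr0 mulr0 scale0r add0r.
rewrite -big_split /= big1 // => j _.
case o : (odd (l + j)).
  by rewrite /F !coef_legendre_odd ?addnS //= ?o // !mul0r !scale0r addr0.
have jl : (j <= l)%N by rewrite -ltnS.
have hj : (2 * (l - j)./2 + j = l)%N.
  by rewrite mul2n even_halfK ?subnK // oddB // -oddD o.
have hj2 : (l - j.+2)./2 = ((l - j)./2).-1.
  by rewrite !subnS; case: (l - j)%N => [|[|n]].
rewrite /F /= hj2 -scalerDl [X in X *: _](_ : _ = 0) ?scale0r //.
have := coef_legendre_rec R l j.
rewrite [X in _ = (_ - X) * _ -> _](_ : l%:R * l.+1%:R = (l * l.+1)%:R); last by rewrite natrM.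
move: hj; set i := (l - j)./2 => hj.
have -> : (l * l.+1 = (2 * i + j) * (2 * i + j).+1)%N by rewrite hj.
move=> H; rewrite [X in X + _]mulrC H; ring.
Qed.
End Zonal.

(** * Chain rules along curves, and tangential derivatives on the sphere *)

Lemma is_derive1_diff (R : realType) (U : normedModType R) (f : R -> U) (t : R)
    (df : U) :
  is_derive t (1 : R) f df -> differentiable f t /\ 'd f t 1 = df.
Proof.
move=> f't; have /derivable1_diffP fd : derivable f t 1 by exact: ex_derive.
by split => //; rewrite -deriveE //; exact: derive_val.
Qed.

Lemma is_derive1_comp_diff (R : realType) (V W : normedModType R)
    (c : R -> V) (dc : V) (f : V -> W) (t : R) :
  is_derive t (1 : R) c dc -> differentiable f (c t) ->
  is_derive t (1 : R) (f \o c) ('d f (c t) dc).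
Proof.
move=> /is_derive1_diff[dct <-] df; have dfc := differentiable_comp dct df.
apply: DeriveDef; first exact/derivable1_diffP.
by rewrite deriveE // diff_comp.
Qed.

Lemma is_derive1_scalel (R : realType) (V : normedModType R) (a : R -> R)
    (da : R) (v : V) (t : R) :
  is_derive t (1 : R) a da ->
  is_derive t (1 : R) (fun s => a s *: v) (da *: v).
Proof.
move=> a't; have [dv E] := is_diff_scalel (a t) v.
by have := is_derive1_comp_diff a't dv; rewrite E.
Qed.


Section TangentialDerivatives.
Variable R : realType.
Implicit Types (f g : 'cV[R]_3 -> R) (x y v w : 'cV[R]_3).

Lemma dotvC x y : dotv x y = dotv y x.
Proof. by apply: eq_bigr => i _; rewrite mulrC. Qed.

Lemma dotvDl x y v : dotv (x + y) v = dotv x v + dotv y v.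
Proof. by rewrite -big_split; apply: eq_bigr => i _; rewrite mxE mulrDl. Qed.

Lemma dotvZl (a : R) x y : dotv (a *: x) y = a * dotv x y.
Proof. by rewrite mulr_sumr; apply: eq_bigr => i _; rewrite mxE mulrA. Qed.

Lemma dotvDr x y v : dotv v (x + y) = dotv v x + dotv v y.
Proof. by rewrite ![dotv v _]dotvC dotvDl. Qed.

Lemma dotvZr (a : R) x y : dotv x (a *: y) = a * dotv x y.
Proof. by rewrite ![dotv x _]dotvC dotvZl. Qed.

Lemma dotv_ge0 x : 0 <= dotv x x.
Proof. by apply: sumr_ge0 => i _; rewrite -expr2 sqr_ge0. Qed.

Lemma dotv_eq0 x : dotv x x = 0 -> x = 0.
Proof.
move/eqP; rewrite psumr_eq0 => [/allP x0|i _]; last by rewrite -expr2 sqr_ge0.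
apply/matrixP => i j; rewrite (ord1 j) mxE; apply/eqP.
by have := x0 i; rewrite mem_index_enum mulf_eq0 orbb; apply.
Qed.

(* Compare [f] and [g] along the great circle through [x] with velocity [v]. *)
Lemma derive_tangent_eq f g x v : S2 x -> dotv x v = 0 ->
  differentiable f x -> differentiable g x -> (forall z, S2 z -> f z = g z) ->
  'D_v f x = 'D_v g x.
Proof.
move=> x1 xv df dg fg.
have [v0|vn0] := eqVneq (dotv v v) 0.
  by rewrite (deriveE _ df) (deriveE _ dg) (dotv_eq0 v0) [LHS]linear0 [RHS]linear0.
pose r := Num.sqrt (dotv v v).
have r2 : r ^+ 2 = dotv v v by rewrite sqr_sqrtr ?dotv_ge0.
have r0 : r != 0 by apply: contra vn0 => /eqP r0; rewrite -r2 r0 expr0n.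
pose a s : R := cos (r * s); pose b s : R := r^-1 * sin (r * s).
pose c s := a s *: x + b s *: v.
have c0 : c 0 = x by rewrite /c /a /b mulr0 cos0 sin0 mulr0 scale1r scale0r addr0.
have cS s : S2 (c s).
  rewrite /S2 /= /c dotvDl !dotvDr !dotvZl !dotvZr x1 mulr1.
  rewrite xv [dotv v x]dotvC xv -r2.
  have := cos2Dsin2 (r * s); rewrite /a /b => <-; field; exact: r0.
have dr (s : R) : is_derive s (1 : R) ( *%R r) r.
  by apply: is_derive_eq; rewrite /GRing.scale /= mulr1.
have da : is_derive (0 : R) (1 : R) a 0.
  have := is_derive1_comp (is_derive_cos (r * 0)) (dr 0).
  by rewrite mulr0 sin0 oppr0 mul0r.
have db : is_derive (0 : R) (1 : R) b 1.
  have H := is_derive1_comp (is_derive_sin (r * 0)) (dr 0).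
  have := is_deriveZ r^-1 H; rewrite mulr0 cos0 mul1r => {H}.
  by rewrite -[_ *: r]/(r^-1 * r) mulVf.
have dc : is_derive (0 : R) (1 : R) c v.
  have := is_deriveD (is_derive1_scalel x da) (is_derive1_scalel v db).
  by rewrite scale0r add0r scale1r.
have df' : differentiable f (c 0) by rewrite c0.
have dg' : differentiable g (c 0) by rewrite c0.
rewrite (deriveE _ df) (deriveE _ dg) -c0.
have [_ <-] := is_derive1_comp_diff dc df'.
have [_ <-] := is_derive1_comp_diff dc dg'.
by rewrite (_ : f \o c = g \o c) //; apply/funext => s /=; exact/fg/cS.
Qed.

Lemma derive_partial f x v : differentiable f x ->
  'D_v f x = dotv v (grad f x).
Proof.
move=> df; rewrite (deriveE _ df) {1}(matrix_sum_delta v) exchange_big /=.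
rewrite big_ord_recl big_ord0 addr0 [LHS]linear_sum; apply: eq_bigr => i _.
by rewrite [LHS]linearZ /= mxE /partial (deriveE _ df).
Qed.

Definition unitv (i : 'I_3) : 'cV[R]_3 := delta_mx i 0.

(** By the triple product, e_i.(x × grad f) = (e_i × x).grad f, so the i-th entry of the surface
    curl is the derivative along this tangent vector. For the surface gradient the same role falls
    to [grad_dir], the projection of e_i to the tangent plane. *)
Definition curl_dir i x := crossv (unitv i) x.

Definition grad_dir i x := unitv i - x i 0 *: x.

Lemma dotv_unitv i x : dotv (unitv i) x = x i 0.
Proof.
rewrite dotvE (bigD1 i) //= mxE !eqxx mul1r big1 ?addr0 // => j ji.
by rewrite mxE (negPf ji) mul0r.
Qed.

Lemma sum3 (F : 'I_3 -> R) : \sum_(i < 3) F i = F 0 + F 1 + F 2.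
Proof.
rewrite !big_ord_recr big_ord0 /= add0r.
by congr (F _ + F _ + F _); exact: val_inj.
Qed.

Lemma ord3P (P : 'I_3 -> Prop) : P 0 -> P 1 -> P 2 -> forall i, P i.
Proof.
move=> P0 P1 P2 [[|[|[|n]]] ni] //.
- by rewrite (_ : Ordinal ni = 0) //; exact: val_inj.
- by rewrite (_ : Ordinal ni = 1) //; exact: val_inj.
- by rewrite (_ : Ordinal ni = 2) //; exact: val_inj.
Qed.

Lemma addo3E :
  (((0 + 1)%R = 1%R :> 'I_3) * ((0 + 2)%R = 2%R :> 'I_3) *
   ((1 + 1)%R = 2%R :> 'I_3) * ((1 + 2)%R = 0%R :> 'I_3) *
   ((2 + 1)%R = 0%R :> 'I_3) * ((2 + 2)%R = 1%R :> 'I_3))%type.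
Proof. by do !split; exact: val_inj. Qed.

Lemma dotv_curl_dir i x y : dotv (curl_dir i x) y = crossv x y i 0.
Proof.
move: i; apply: ord3P; rewrite dotvE sum3 /curl_dir !mxE !addo3E !eqxx /=; ring.
Qed.

Lemma curl_dir_orth i x : dotv x (curl_dir i x) = 0.
Proof. by rewrite dotvC dotv_curl_dir mxE; ring. Qed.

Lemma grad_dir_orth i x : S2 x -> dotv x (grad_dir i x) = 0.
Proof.
by move=> x1; rewrite dotvC dotvDl dotv_unitv -scaleNr dotvZl x1 mulr1 subrr.
Qed.

Lemma crossvN x y : crossv y x = - crossv x y.
Proof. by apply/matrixP => i j; rewrite !mxE; ring. Qed.

(** This and the next three lemmas put Q, R, V, W into the shapes (v.y)(x.w) and v.w, which arise
    when P_l(x.y) is differentiated along v in x and along w in y. The minus sign in Q comes from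
    (e_j × y).x = -(x × y)_j. *)
Lemma matQE x y i j :
  matQ x y i j = dotv (curl_dir i x) y * dotv x (curl_dir j y).
Proof.
rewrite [dotv x _]dotvC !dotv_curl_dir crossvN !mxE big_ord1 !mxE; ring.
Qed.

Lemma matRE x y i j : matR x y i j = dotv (curl_dir i x) (curl_dir j y).
Proof.
rewrite dotv_curl_dir; move: i j.
by apply: ord3P; apply: ord3P; rewrite !mxE big_ord1 dotvE !sum3 !mxE !addo3E ?eqxx /=; ring.
Qed.

Lemma matVE x y i j :
  matV x y i j = dotv (grad_dir i x) y * dotv x (grad_dir j y).
Proof.
rewrite [dotv x _]dotvC !dotvDl !dotv_unitv -!scaleNr !dotvZl !mxE big_ord1 !mxE.
by rewrite [dotv y x]dotvC; ring.
Qed.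

Lemma matWE x y i j : matW x y i j = dotv (grad_dir i x) (grad_dir j y).
Proof.
rewrite mxE; apply: eq_bigr => k _; rewrite !mxE !big_ord1 !mxE.
by rewrite andbT [k == j]eq_sym andbT [i == k]eq_sym [j == k]eq_sym; ring.
Qed.

Lemma surf_curlE f x i : differentiable f x ->
  surf_curl f x i 0 = 'D_(curl_dir i x) f x.
Proof.
by move=> df; rewrite derive_partial // dotv_curl_dir.
Qed.

Lemma surf_gradE f x i : differentiable f x ->
  surf_grad f x i 0 = 'D_(grad_dir i x) f x.
Proof.
move=> df; rewrite derive_partial // /surf_grad /grad_dir mulmxBl mul1mx.
rewrite dotvDl dotv_unitv !mxE; congr (_ + _).
rewrite -scaleNr dotvZl mulNr; congr (- _).
by rewrite mulr_sumr; apply: eq_bigr => j _; rewrite mxE big_ord1 !mxE mulrA.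
Qed.


End TangentialDerivatives.

(** * Derivatives of functions of x.y *)

Section DotDerivatives.
Variable R : realType.
Implicit Types (x y v w : 'cV[R]_3) (p : {poly R}).

Definition dotl y x : R := dotv x y.

Lemma dotl_linear y : linear (dotl y).
Proof. by move=> a u v; rewrite /dotl dotvDl dotvZl. Qed.

HB.instance Definition _ y :=
  GRing.isLinear.Build R 'cV[R]_3 R *%R (dotl y) (dotl_linear y).

Lemma dotl_continuous y : continuous (dotl y).
Proof.
have -> : dotl y = fun x => x 0 0 * y 0 0 + x 1 0 * y 1 0 + x 2 0 * y 2 0.
  by apply/funext => x; rewrite /dotl dotvE sum3.
have c i : continuous (fun x : 'cV[R]_3 => x i 0 * y i 0).
  by move=> x; apply: continuousM; [exact: coord_continuous|exact: cst_continuous].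
by move=> x; exact: (continuousD (continuousD (c 0 x) (c 1 x)) (c 2 x)).
Qed.

Lemma is_derive_dotl x v y : differentiable (dotl y) x /\ 'D_v (dotl y) x = dotv v y.
Proof.
have d : differentiable (dotl y) x by apply/linear_differentiable/dotl_continuous.
by split => //; rewrite deriveE // diff_lin //; exact: dotl_continuous.
Qed.

Lemma horner_is_derive p (t : R) : is_derive t (1 : R) (horner p) (p^`()%R.[t]).
Proof. by apply: is_derive_eq. Qed.

Lemma is_derive_horner_dotl p x v y :
  differentiable (horner p \o dotl y) x /\
  'D_v (horner p \o dotl y) x = p^`()%R.[dotv x y] * dotv v y.
Proof.
have [d dE] := is_derive_dotl x v y.
have [dp dpE] := is_derive1_diff (horner_is_derive p (dotl y x)).
have dc := differentiable_comp d dp; split => //.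
rewrite deriveE // diff_comp // [LHS]/= -(deriveE v d) dE.
have L (a : R) : 'd (horner p) (dotl y x) a = a * 'd (horner p) (dotl y x) 1.
  by rewrite -{1}[a]mulr1; exact: (linearZ_LR ('d (horner p) (dotl y x)) a 1).
by rewrite L dpE mulrC.
Qed.
End DotDerivatives.

(** * The addition theorem, its tangential derivatives and the resulting bounds *)

Section AdditionTheorem.
Variable R : realType.
Implicit Types (f g : 'cV[R]_3 -> R) (x y v w : 'cV[R]_3).

Lemma S2_sph_point (theta phi : R) : S2 (sph_point theta phi).
Proof.
rewrite /S2 /= dotvE sum3 !mxE /=.
rewrite -[RHS](cos2Dsin2 theta) -[X in _ = _ + X]mulr1 -(cos2Dsin2 phi); ring.
Qed.

Lemma eq_sphere_integral f g : (forall x, S2 x -> f x = g x) ->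
  sphere_integral f = sphere_integral g.
Proof.
move=> fg; rewrite /sphere_integral; apply: eq_Rintegral => phi _.
by apply: eq_Rintegral => theta _; rewrite fg //; exact: S2_sph_point.
Qed.

Variables (l : nat) (Y : 'I_(2 * l + 1) -> 'cV[R]_3 -> R).
Hypothesis Y_basis : orthonormal_basis_harmonics Y.

(** The zonal function with pole y is itself a spherical harmonic of degree l, hence a combination
    of the basis. By orthonormality its k-th coefficient is its integral against [Y k], which the
    reproducing property evaluates at y. *)
Lemma addition_theorem x y : S2 x -> S2 y ->
  \sum_k Y k x * Y k y = (2 * l + 1)%:R / (4 * pi) * (legendre R l).[dotv x y].
Proof.
move=> x1 y1; have [Yh Yo Yb] := Y_basis.

have [p Hp] := boolp.choice Yh.
have Op j k : sph_int (p j * p k) = (j == k)%:R.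
  rewrite -Yo; apply: eq_sphere_integral => z z1; rewrite /ev mevalM.
  have [_ _ ->] := Hp j => //; by have [_ _ ->] := Hp k.
have [|c Hc] := Yb (ev (zonal l y)).
  by exists (zonal l y); split; [exact: dhomog_zonal|exact: laplacian_zonal|].
have cE k : c k = 4 * pi / (2 * l + 1)%:R * Y k y.
  have [ph p0 pY] := Hp k.
  rewrite pY // -(sph_int_legendre y1 ph p0).
  transitivity (sph_int (p k * \sum_j c j *: p j)).
    rewrite mulr_sumr [sph_int _]linear_sum (bigD1 k) //= big1 ?addr0 => [|j jk].
      by rewrite -scalerAr [sph_int _]linearZ /= Op eqxx mulr1.
    by rewrite -scalerAr [sph_int _]linearZ /= Op eq_sym (negPf jk) mulr0.
  apply: eq_sphere_integral => z z1; rewrite /ev !mevalM; congr (_ * _).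
  rewrite -/(ev _ _) -/(ev _ _) ev_legendre_linform -ev_zonal // Hc // /ev linear_sum.
  by apply: eq_bigr => j _; rewrite /= mevalZ; have [_ _ ->] := Hp j.
rewrite -ev_zonal // Hc // mulr_sumr; apply: eq_bigr => k _; rewrite cE.
have l0 : (2 * l + 1)%:R != 0 :> R by rewrite pnatr_eq0 addn1.
have p0 : pi != 0 :> R by rewrite gt_eqF // pi_gt0.
by move: l0 p0; move: (_%:R) (pi) => a b a0 b0; field; rewrite a0 b0.
Qed.

Hypothesis Y_smooth : forall k, smooth_near_S2 (Y k).

Lemma Y_diff k x : S2 x -> differentiable (Y k) x.
Proof.
have [U [_ SU Uk]] := Y_smooth k; have [Ud _] := Uk 1%N.
by move=> /SU; exact: Ud.
Qed.

(** With x frozen, the addition theorem is an equality of two functions of y on the sphere only.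
    [derive_tangent_eq] still allows it to be differentiated along w, because w is tangent at y. *)
Lemma derive_Y_left x y w : S2 x -> S2 y -> dotv y w = 0 ->
  \sum_k Y k x * 'D_w (Y k) y =
  (2 * l + 1)%:R / (4 * pi) * ((legendre R l)^`()%R.[dotv x y] * dotv x w).
Proof.
move=> x1 y1 yw; set c := _ / _.
have [d dE] := is_derive_horner_dotl (legendre R l) y w x.
have dY k : differentiable (Y k) y by exact: Y_diff.
have -> : \sum_k Y k x * 'D_w (Y k) y = 'D_w (\sum_k Y k x *: Y k) y.
  rewrite derive_sum => [|k]; last by apply/derivableZ/diff_derivable.
  by apply: eq_bigr => k _; rewrite deriveZ //; exact: diff_derivable.
rewrite (@derive_tangent_eq _ _ (c *: (horner (legendre R l) \o dotl x))) //.
- rewrite deriveZ; last exact: diff_derivable.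
  by rewrite dE [dotv y x]dotvC [dotv w x]dotvC.
- by apply: differentiable_sum => k; exact: differentiableZ.
- exact: differentiableZ.
- move=> z z1; rewrite fct_sumE /= -[RHS]/(c * (legendre R l).[dotv z x]).
  by rewrite dotvC -addition_theorem.
Qed.

(** As a function of x the right side of [derive_Y_left] is P_l'(x.y) times the linear form x.w, up
    to a constant; the product rule gives the two terms. *)
Lemma derive_Y_both x v y w : S2 x -> S2 y -> dotv x v = 0 -> dotv y w = 0 ->
  \sum_k 'D_v (Y k) x * 'D_w (Y k) y =
  (2 * l + 1)%:R / (4 * pi) *
  ((legendre R l)^`()^`().[dotv x y] * (dotv v y * dotv x w) +
   (legendre R l)^`().[dotv x y] * dotv v w).
Proof.
move=> x1 y1 xv yw; set c := _ / _.
have [d dE] := is_derive_horner_dotl (legendre R l)^`() x v y.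
have [d' dE'] := is_derive_dotl x v w.
have dY k : differentiable (Y k) x by exact: Y_diff.
have -> : \sum_k 'D_v (Y k) x * 'D_w (Y k) y =
    'D_v (\sum_k 'D_w (Y k) y *: Y k) x.
  rewrite derive_sum => [|k]; last by apply/derivableZ/diff_derivable.
  by apply: eq_bigr => k _; rewrite deriveZ; [rewrite mulrC|exact: diff_derivable].
rewrite (@derive_tangent_eq _ _
  (c *: ((horner (legendre R l)^`() \o dotl y) * dotl w))) //.
- rewrite deriveZ; last by apply: derivableM; exact: diff_derivable.
  rewrite deriveM; [|exact: diff_derivable|exact: diff_derivable].
  rewrite dE dE' -![_ *: _]/(_ * _) /= /dotl; congr (_ * _); ring.
- by apply: differentiable_sum => k; exact: differentiableZ.
- by apply: differentiableZ; exact: differentiableM.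
- move=> z z1; rewrite fct_sumE /=.
  rewrite -[RHS]/(c * ((legendre R l)^`().[dotv z y] * dotv z w)).
  rewrite -derive_Y_left //.
  by apply: eq_bigr => k _; rewrite mulrC.
Qed.
(** Cauchy-Schwarz for two sums with the same bound, where 2|ab| <= a^2 + b^2 suffices. *)
Lemma normr_sum_mul_le (n : nat) (a b : 'I_n -> R) (m : R) :
  \sum_k a k * a k <= m -> \sum_k b k * b k <= m -> `|\sum_k a k * b k| <= m.
Proof.
move=> am bm; apply: (le_trans (ler_norm_sum _ _ _)).
apply: (@le_trans _ _ (\sum_k (a k * a k + b k * b k) / 2)).
  apply: ler_sum => k _; rewrite ler_norml; apply/andP; split.
    by have := sqr_ge0 (a k + b k); rewrite expr2; lra.
  by have := sqr_ge0 (a k - b k); rewrite expr2; lra.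
by rewrite -mulr_suml big_split /=; lra.
Qed.

Lemma addition_factor_ge0 : 0 <= (2 * l + 1)%:R / (4 * pi) :> R.
Proof. by rewrite divr_ge0 // mulr_ge0 // pi_ge0. Qed.

(** For x = y and v = w the P_l'' term has the factor x.v = 0, and P_l'(1) = l(l+1)/2 remains.
    Cauchy-Schwarz carries this bound to all pairs of points and directions. *)
Lemma derive_Y_bound x v y w : S2 x -> S2 y -> dotv x v = 0 -> dotv y w = 0 ->
  dotv v v <= 1 -> dotv w w <= 1 ->
  `|\sum_k 'D_v (Y k) x * 'D_w (Y k) y| <=
  (2 * l + 1)%:R / (4 * pi) * ((l * l.+1)%:R / 2).
Proof.
move=> x1 y1 xv yw v1 w1; set c := _ / _; set d := _ / 2.
have cd0 : 0 <= c * d.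
  by rewrite mulr_ge0 //; [exact: addition_factor_ge0|exact: divr_ge0].
have D z u : S2 z -> dotv z u = 0 -> dotv u u <= 1 ->
    \sum_k 'D_u (Y k) z * 'D_u (Y k) z <= c * d.
  move=> z1 zu u1; rewrite derive_Y_both // (z1 : dotv z z = 1) zu mulr0 mulr0 add0r.
  by rewrite deriv_legendre_at1 -/d -/c mulrA ler_piMr.
by apply: normr_sum_mul_le; exact: D.
Qed.

Lemma legendre_bounds (t : R) : -1 <= t <= 1 ->
  `|(legendre R l).[t]| <= 1 /\ `|(legendre R l)^`().[t]| <= (l * l.+1)%:R / 2.
Proof.
move=> /andP[t1 t2].
pose x : 'cV[R]_3 := unitv R 0.
pose y : 'cV[R]_3 := t *: unitv R 0 + Num.sqrt (1 - t ^+ 2) *: unitv R 1.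
(* Orthogonal to both [x] and [y], hence tangent at both. With this direction used twice the P_l''
   term vanishes, so the bound on the sum over k is a bound on P_l'(t) alone. *)
pose v : 'cV[R]_3 := unitv R 2.
have x1 : S2 x by rewrite /S2 /= /x dotv_unitv mxE.
have y1 : S2 y.
  rewrite /S2 /= dotvE sum3 !mxE /= !mulr1 !mulr0 !addr0 add0r -expr2 -expr2 sqr_sqrtr; last nra.
  ring.
have xy : dotv x y = t by rewrite /x dotv_unitv !mxE /= mulr1 mulr0 addr0.
have xv : dotv x v = 0 by rewrite /x dotv_unitv mxE.
have yv : dotv y v = 0 by rewrite dotvC /v dotv_unitv !mxE /= !mulr0 addr0.
have v1 : dotv v v = 1 by rewrite /v dotv_unitv mxE.
set c : R := (2 * l + 1)%:R / (4 * pi).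
have c0 : 0 < c by rewrite divr_gt0 ?ltr0n ?addn1 // mulr_gt0 // pi_gt0.
split.
  rewrite -(ler_pM2l c0) mulr1 -[X in X * _](gtr0_norm c0) -normrM -xy -addition_theorem //.
  by apply: normr_sum_mul_le; rewrite addition_theorem // (_ : dotv _ _ = 1) // legendre_at1 mulr1.
rewrite -(ler_pM2l c0) -[X in X * `|_|](gtr0_norm c0) -normrM.
have := @derive_Y_bound x v y v x1 y1 xv yv; rewrite v1 => /(_ (lexx _) (lexx _)).
by rewrite derive_Y_both // xv !mulr0 add0r v1 mulr1 xy.
Qed.

End AdditionTheorem.

(** * Dominated series and interchange of limits *)

Section SeriesBounds.
Variable R : realType.

Lemma series_tail_bound (u b : nat -> R) : (forall l, `|u l| <= b l) ->
  cvgn (series b) -> cvgn (series u) /\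
  forall n, `|limn (series u) - series u n| <= limn (series b) - series b n.
Proof.
move=> ub cb; have b0 l : 0 <= b l by exact: le_trans (ub l).
have cu : cvgn (series u).
  apply: (@normed_cvg R R^o); apply: series_le_cvg cb => // l.
  exact: normr_ge0.
split=> // n.
have cun : (fun m => series u m - series u n) @ \oo --> limn (series u) - series u n.
  by apply: cvgB; [exact: cu|exact: cvg_cst].
have cbn : (fun m => series b m - series b n) @ \oo --> limn (series b) - series b n.
  by apply: cvgB; [exact: cb|exact: cvg_cst].
rewrite -(cvg_lim _ cun) // -(cvg_lim _ cbn) // -lim_norm //; last first.
  by apply/cvg_ex; exists (limn (series u) - series u n).
apply: ler_lim.
- by apply: is_cvg_norm; apply/cvg_ex; exists (limn (series u) - series u n).
- by apply/cvg_ex; exists (limn (series b) - series b n).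
near=> m; have nm : (n <= m)%N by near: m; exact: nbhs_infty_ge.
rewrite !sub_series_geq //; apply: le_trans (ler_norm_sum _ _ _) _.
by apply: ler_sum => l _.
Unshelve. all: by end_near. Qed.

Lemma series_tail_cvg0 (b : nat -> R) : cvgn (series b) ->
  (fun n => limn (series b) - series b n) @ \oo --> 0.
Proof.
by move=> cb; rewrite -(subrr (limn (series b))); apply: cvgB; [exact: cvg_cst|exact: cb].
Qed.

(** The three-epsilon argument for an arbitrary filter. It serves both the continuity of a Legendre
    series and the limit of the kernels along generic pairs. *)
Lemma cvg_unif_approx (T : Type) (F : set_system T) (FF : Filter F)
    (V : normedModType R) (f : T -> V) (fn : nat -> T -> V) (l : V)
    (ln : nat -> V) (r : nat -> R) :
  (forall n, \forall x \near F, `|f x - fn n x| <= r n) ->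
  (forall n, fn n x @[x --> F] --> ln n) -> (forall n, `|l - ln n| <= r n) ->
  r @ \oo --> 0 -> f x @[x --> F] --> l.
Proof.
move=> fr fnl lr r0; apply/cvgrPdist_lt => e e0.
have e3 : 0 < e / 3 by rewrite divr_gt0.
have [n rn] : exists n, r n < e / 3.
  have /cvgrPdist_lt /(_ _ e3) := r0; case=> n _ /(_ n (leqnn n)) /=.
  by rewrite sub0r normrN => /(le_lt_trans (ler_norm _)); exists n.
have /cvgrPdist_lt /(_ _ e3) := fnl n.
have := fr n; apply: filterS2 => x H1 H2.
rewrite (_ : l - f x = (l - ln n) + (ln n - fn n x) + (fn n x - f x)); last first.
  by rewrite !addrA subrK subrK.
have H3 := lr n; rewrite distrC in H1.
apply: le_lt_trans (ler_normD _ _) _; apply: le_lt_trans (lerD (ler_normD _ _) (lexx _)) _.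
lra.
Qed.

Lemma cvg_dist_le (V : normedModType R) (u : nat -> V) (l : V) (r : nat -> R) :
  (forall n, `|l - u n| <= r n) -> r @ \oo --> 0 -> u @ \oo --> l.
Proof.
move=> lr r0; apply/cvgrPdist_lt => e e0.
have /cvgrPdist_lt /(_ _ e0) := r0; apply: filterS => n /=.
rewrite sub0r normrN => re; apply: le_lt_trans (lr n) _.
exact: le_lt_trans (ler_norm _) re.
Qed.

Lemma sum1_series (V : zmodType) (u : nat -> V) n : u 0%N = 0 ->
  \sum_(1 <= l < n) u l = \sum_(0 <= l < n) u l.
Proof.
by move=> u0; case: n => [|n]; [rewrite !big_geq|rewrite [RHS]big_ltn // u0 add0r].
Qed.

End SeriesBounds.

(** * Continuous functions orthogonal to all polynomials *)

Section Density.
Variable R : realType.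
Local Notation mu := (@lebesgue_measure R).

(* The retraction of the line onto [-1, 1]. *)
Definition clamp (t : R) : R := (`|t + 1| - `|t - 1|) / 2.

Lemma clamp_itv t : -1 <= clamp t <= 1.
Proof.
have := ler_normB (t + 1) (t - 1); have := lerB_dist (t + 1) (t - 1).
have := lerB_dist (t - 1) (t + 1); rewrite distrC.
have -> : t + 1 - (t - 1) = 2 by ring.
by rewrite [`|2|]normr_nat /clamp => ? ? ?; apply/andP; split; lra.
Qed.

Lemma clamp_id t : -1 <= t <= 1 -> clamp t = t.
Proof.
by move=> /andP[t1 t2]; rewrite /clamp ger0_norm ?ler0_norm; lra.
Qed.

Lemma continuous_clamp : continuous clamp.
Proof.
have c (a : R) : continuous (fun t : R => `|t + a|).
  by move=> t; apply: cvg_norm; apply: cvgD; [exact: cvg_id|exact: cvg_cst].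
by move=> t; apply: cvgM; [apply: cvgB; exact: c|exact: cvg_cst].
Qed.

(** Trades continuity within the interval for continuity on the whole line, the form in which the
    integration lemmas above ask for it. *)
Lemma continuous_comp_clamp (f : R -> R) : {within `[-1, 1], continuous f} ->
  continuous (f \o clamp).
Proof.
move=> /subspace_continuousP cf t.
have /cf H : `[-1, 1]%classic (clamp t) by rewrite /= in_itv /= clamp_itv.
apply: cvg_trans H => A /= [e e0 He].
have /cvgrPdist_lt /(_ _ e0) := @continuous_clamp t : clamp x @[x --> t] --> clamp t.
apply: filterS => s Hs.
by apply: He => //=; rewrite in_itv /= clamp_itv.
Qed.

(* If [D t0 > 0] then the powers of [1 + (d ^ 2 - (t - t0) ^ 2) / 4], which
   lie in [0, 1] away from [t0] and grow near it, are polynomials with an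
   arbitrarily large integral against [D]. *)
Lemma continuous_orthogonal_poly (D : R -> R) (t0 : R) : continuous D ->
  (forall p : {poly R}, \int[mu]_(t in `[-1, 1]) (D t * p.[t]) = 0) ->
  -1 < t0 < 1 -> D t0 <= 0.
Proof.
move=> cD Dp /andP[t1 t2]; rewrite leNgt; apply/negP => D0.
have D20 : 0 < D t0 / 2 by lra.
have [d [d0 dt1 dt2 dD]] : exists d : R, [/\ 0 < d, -1 <= t0 - d, t0 + d <= 1 &
    forall t, `|t0 - t| < d -> D t0 / 2 <= D t].
  have /cvgrPdist_lt /(_ _ D20) [e /= e0 He] := cD t0 : D x @[x --> t0] --> D t0.
  exists (Num.min e (Num.min (t0 + 1) (1 - t0))); split.
  - by rewrite !lt_min e0 /=; apply/andP; split; lra.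
  - have : Num.min e (Num.min (t0 + 1) (1 - t0)) <= t0 + 1.
      by rewrite !ge_min lexx !orbT.
    lra.
  - have : Num.min e (Num.min (t0 + 1) (1 - t0)) <= 1 - t0.
      by rewrite !ge_min lexx !orbT.
    lra.
  - move=> t; rewrite lt_min => /andP[/He /=].
    by move=> /ltW; rewrite ler_norml => /andP[_ ?] _; lra.
have [M M0 DM] : exists2 M : R, 0 <= M & forall t, -1 <= t <= 1 -> `|D t| <= M.
  have [c cI Hc] := @EVT_max R (fun t => `|D t|) (-1) 1 ltac:(lra)
    (continuous_subspaceT (fun x => continuous_comp (cD x) (@norm_continuous _ _ (D x)))).
  exists `|D c| => // t t11; apply: Hc; by rewrite in_itv.
(* The factor 1/4 keeps q nonnegative on the interval, where (t - t0)^2 <= 4. *)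
pose q : {poly R} := 1 + (4^-1)%:P * ((d ^+ 2)%:P - ('X - t0%:P) ^+ 2).
have qE t : q.[t] = 1 + (d ^+ 2 - (t - t0) ^+ 2) / 4.
  by rewrite !hornerE; field.
pose h t := (Num.max (d ^+ 2 - (t - t0) ^+ 2) 0 : R).
pose H := \int[mu]_(t in `[-1, 1]) h t.
have ch : continuous h.
  have -> : h = fun t => (d ^+ 2 - (t - t0) ^+ 2 + `|d ^+ 2 - (t - t0) ^+ 2|) / 2.
    by apply/funext => t; rewrite /h maxr_absE subr0 addr0.
  pose g : {poly R} := (d ^+ 2)%:P - ('X - t0%:P) ^+ 2.
  have -> : (fun t => (d ^+ 2 - (t - t0) ^+ 2 + `|d ^+ 2 - (t - t0) ^+ 2|) / 2) =
      fun t => (g.[t] + `|g.[t]|) / 2.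
    by apply/funext => t; rewrite !hornerE.
  move=> t; apply: cvgM; last exact: cvg_cst.
  by apply: cvgD; [|apply: cvg_norm]; exact: continuous_horner.
have cc (c : R) f : continuous f -> continuous (fun t : R => c * f t).
  by move=> cf t; apply: cvgM; [exact: cvg_cst|exact: cf].
have ih a b : mu.-integrable `[a, b] (EFin \o h) by exact: continuous_integrable_itvcc.
have h0 t : 0 <= h t by rewrite le_max lexx orbT.
have H0 : 0 < H.
  pose a := t0 - d / 2; pose b := t0 + d / 2.
  have ab : a < b by rewrite /a /b; lra.
  have a1 : -1 <= a by rewrite /a; lra.
  have b1 : b <= 1 by rewrite /b; lra.
  have E1 := @Rintegral_itvB R h (BLeft (-1)) (BRight 1) b (ih _ _).
  have E2 := @Rintegral_itvB R h (BLeft (-1)) (BRight b) a (ih _ _).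
  move: E1 E2; rewrite !bnd_simp => /(_ (le_trans a1 (ltW ab)) b1) E1.
  move=> /(_ a1 (ltW ab)) E2.
  have P1 : 0 <= \int[mu]_(x in `]b, 1]) h x by apply: Rintegral_ge0 => x _; exact: h0.
  have P2 : 0 <= \int[mu]_(x in `[-1, a]) h x by apply: Rintegral_ge0 => x _; exact: h0.
  have P3 : 3 / 4 * d ^+ 2 * d <= \int[mu]_(x in `]a, b]) h x.
    have -> : 3 / 4 * d ^+ 2 * d = \int[mu]_(x in `]a, b]) (3 / 4 * d ^+ 2).
      rewrite Rintegral_cst //= lebesgue_measure_itv /= lte_fin ab /=.
      by rewrite /a /b; field.
    apply: le_Rintegral => //.
    - apply: integrableS
        (continuous_integrable_itvcc a b (@cst_continuous _ _ (3 / 4 * d ^+ 2))) => //.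
      exact: subset_itv_oc_cc.
    - by apply: integrableS (ih a b) => //; exact: subset_itv_oc_cc.
    move=> x; rewrite /= in_itv /= /a /b => /andP[x1 x2].
    rewrite /h le_max; apply/orP; left; move: x1 x2 d0.
    by clear; move=> x1 x2 d0; nra.
  have : 0 < 3 / 4 * d ^+ 2 * d by rewrite !mulr_gt0 // exprn_gt0.
  move: E1 E2 P1 P2 P3; rewrite /H.
  move: (Rintegral _ _ _) (Rintegral _ _ _) (Rintegral _ _ _) (Rintegral _ _ _) (Rintegral _ _ _).
  by clear; move=> *; lra.
have bernoulli (x : R) n : 0 <= x -> n%:R * x <= (1 + x) ^+ n.
  move=> x0; suff : 1 + n%:R * x <= (1 + x) ^+ n by lra.
  elim: n => [|n IH]; first by rewrite expr0 mul0r addr0.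
  rewrite exprS -natr1; have : 0 <= n%:R * x by rewrite mulr_ge0.
  nra.
have m11 : (-1 : R) < 1 by lra.
(* Pointwise, D q^n is at least n D(t0) h / 8 - M: near t0 by Bernoulli's inequality and D >=
   D(t0)/2, elsewhere because h = 0 and q^n lies in [0, 1]. The integral of D q^n is 0, which is
   absurd for large n. *)
have bound n : n%:R * (D t0 / 2 / 4 * H) - M * 2 <= 0.
  have -> : n%:R * (D t0 / 2 / 4 * H) - M * 2 =
      \int[mu]_(t in `[-1, 1]) (n%:R * (D t0 / 2 / 4) * h t - M).
    rewrite RintegralB //;
      [|exact/continuous_integrable_itvcc/cc|exact/continuous_integrable_itvcc/cst_continuous].
    rewrite RintegralZl // Rintegral_cst //= lebesgue_measure_itv /= lte_fin m11 /=.
    by rewrite -/H; ring.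
  rewrite -(Dp (q ^+ n)); apply: le_Rintegral => //.
  - apply: continuous_integrable_itvcc => t; apply: cvgB; [exact: cc|exact: cvg_cst].
  - apply: continuous_integrable_itvcc => t; apply: cvgM; [exact: cD|exact: continuous_horner].
  move=> t; rewrite /= in_itv /= => t11.
  rewrite horner_exp; have [td|td] := ltP `|t0 - t| d.
    have DD := dD _ td.
    have s0 : 0 <= (d ^+ 2 - (t - t0) ^+ 2) / 4.
      by move: td; rewrite ltr_norml => /andP[? ?]; nra.
    have hE : h t = 4 * ((d ^+ 2 - (t - t0) ^+ 2) / 4) by rewrite /h max_l; [field|lra].
    have := bernoulli _ n s0; rewrite qE hE; move: (_ / 4) s0 => s s0 B.
    have X0 : 0 <= (1 + s) ^+ n by rewrite exprn_ge0 //; lra.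
    have : D t0 / 2 * (n%:R * s) <= D t * (1 + s) ^+ n.
      apply: ler_pM => //; first lra.
      by rewrite mulr_ge0.
    lra.
  have d2 : d ^+ 2 <= (t - t0) ^+ 2.
    rewrite -[X in _ <= X]sqrrN opprB -[X in _ <= X]real_normK ?num_real //.
    by rewrite ler_sqr ?nnegrE // ltW.
  have hE : h t = 0 by rewrite /h max_r // subr_le0.
  rewrite hE mulr0 sub0r.
  have q01 : 0 <= q.[t] <= 1.
    rewrite qE; move: d2; have : (t - t0) ^+ 2 <= 4 by move: t11 => /andP[? ?]; nra.
    have : 0 <= d ^+ 2 by rewrite sqr_ge0.
    by move=> ? ? ?; apply/andP; split; lra.
  have /andP[q0 q1] := q01.
  have qn0 : 0 <= q.[t] ^+ n by exact: exprn_ge0.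
  have qn1 : q.[t] ^+ n <= 1 by exact: exprn_ile1.
  have := DM _ t11; rewrite ler_norml => /andP[D1 D2].
  have : - M * q.[t] ^+ n <= D t * q.[t] ^+ n by exact: ler_wpM2r.
  nra.
have c0 : 0 < D t0 / 2 / 4 * H by rewrite mulr_gt0 //; lra.
have := archi_boundP (x := M * 2 / (D t0 / 2 / 4 * H)).
rewrite divr_ge0 ?(ltW c0) ?mulr_ge0 // => /(_ isT).
by rewrite ltr_pdivrMr // ltNge -subr_le0 bound.
Qed.


Lemma continuous_orthogonal_poly0 (D : R -> R) : continuous D ->
  (forall p : {poly R}, \int[mu]_(t in `[-1, 1]) (D t * p.[t]) = 0) ->
  forall t, -1 <= t <= 1 -> D t = 0.
Proof.
move=> cD Dp.
have D0 t : -1 < t < 1 -> D t = 0.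
  move=> t1; apply/eqP; rewrite eq_le (continuous_orthogonal_poly cD Dp t1) /=.
  rewrite -oppr_le0; apply: (@continuous_orthogonal_poly (fun t => - D t)) => //.
    by move=> x; apply: cvgN; exact: cD.
  move=> p; have := Dp (- p); under eq_Rintegral do rewrite hornerN mulrN -mulNr.
  by [].
move=> t t1; apply/eqP; rewrite -normr_eq0 -[_ == 0]negbK; apply/negP => n0.
have Dt0 : 0 < `|D t| by rewrite lt_def n0 normr_ge0.
have /cvgrPdist_lt /(_ _ Dt0) [e /= e0 He] := cD t : D x @[x --> t] --> D t.
(* The point (1 - d) t lies in the open interval, at distance less than e from t. This reaches the
   endpoints by continuity. *)
pose d := Num.min (e / 2) (1 / 2).
have d0 : 0 < d by rewrite lt_min; apply/andP; split; lra.
have d1 : d <= e / 2 by rewrite ge_min lexx.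
have d2 : d <= 1 / 2 by rewrite ge_min lexx orbT.
have /He : `|t - (1 - d) * t| < e.
  have -> : t - (1 - d) * t = d * t by ring.
  rewrite normrM (gtr0_norm d0).
  have : `|t| <= 1 by rewrite ler_norml.
  nra.
move: t1 => /andP[t1 t2].
by rewrite /= (D0 ((1 - d) * t)) ?subr0 ?ltxx //; apply/andP; split; nra.
Qed.

End Density.

(** * Orthogonality of Legendre polynomials, from integrals over the sphere *)

Section LegendreOrthogonality.
Variable R : realType.
Local Notation mu := (@lebesgue_measure R).
Implicit Types (p : {poly R}) (a b t : R).

Lemma Rintegral_deriv_poly p a b : a < b ->
  \int[mu]_(t in `[a, b]) p^`()%R.[t] = p.[b] - p.[a].
Proof.
move=> ab; apply: Rintegral_derive => //; last exact: continuous_horner.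
Qed.

Lemma Rintegral_poly_sum p a b :
  \int[mu]_(t in `[a, b]) p.[t] =
  \sum_(j < size p) p`_j * \int[mu]_(t in `[a, b]) t ^+ j.
Proof.
have cX j : continuous (fun t : R => t ^+ j).
  by move=> t; have := @continuous_horner R 'X^j t;
     rewrite (_ : horner 'X^j = fun t => t ^+ j) //; apply/funext => s; rewrite hornerXn.
under eq_Rintegral do rewrite horner_coef.
rewrite Rintegral_sum_continuous => [|j]; last first.
  by move=> t; apply: cvgM; [exact: cvg_cst|exact: cX].
apply: eq_bigr => j _; rewrite RintegralZl //.
exact: continuous_integrable_itvcc.
Qed.

Local Notation pole := (unitv R 2).

Lemma pole1 : dotv pole pole = 1.
Proof. by rewrite dotv_unitv mxE. Qed.

(** Archimedes' projection onto the axis, for powers. Instead of a change of variables, both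
    one-dimensional integrals are computed: times j + 1 each is 1 - (-1)^(j+1). *)
Lemma sph_int_pole_exp j : sph_int (linform pole ^+ j) =
  2 * pi * \int[mu]_(t in `[-1, 1]) t ^+ j.
Proof.
have j0 : j.+1%:R != 0 :> R by rewrite pnatr_eq0.
have I1 : j.+1%:R * \int[mu]_(t in `[-1, 1]) t ^+ j = 1 - (-1) ^+ j.+1.
  have m11 : (-1 : R) < 1 by lra.
  have := Rintegral_deriv_poly 'X^(j.+1) m11.
  rewrite !hornerXn expr1n => <-; rewrite derivXn -RintegralZl //.
    by apply: eq_Rintegral => t _; rewrite hornerMn hornerXn mulr_natl.
  apply: continuous_integrable_itvcc => t; have := @continuous_horner R 'X^j t.
  by rewrite (_ : horner 'X^j = fun t => t ^+ j) //; apply/funext => s; rewrite hornerXn.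
have I2 : j.+1%:R * trig_integral 0 pi 1 j = 1 - (-1) ^+ j.+1 :> R.
  have := Rintegral_derive (@is_derive_sinX_cosX R 0 j.+1).
  move=> /(_ 0 pi) H; rewrite /trig_integral -RintegralZl //; last first.
    exact/continuous_integrable_itvcc/continuous_sinX_cosX.
  have {}H := H _ (pi_gt0 R).
  have cf : continuous (fun x : R => j.+1%:R * (sin x ^+ 1 * cos x ^+ j)).
    by move=> x; apply: cvgM; [exact: cvg_cst|exact: continuous_sinX_cosX].
  move: H; rewrite (_ : Rintegral _ _ _ = -1 * Rintegral mu `[0, pi] (fun x =>
    j.+1%:R * (sin x ^+ 1 * cos x ^+ j))); last first.
    rewrite -RintegralZl //; last exact: (continuous_integrable_itvcc _ _ cf).
    by apply: eq_Rintegral => x _; rewrite mul0r sub0r mulN1r.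
  rewrite !expr0 !mul1r cospi cos0 expr1n => H.
  rewrite -[LHS]opprK -[X in - X]mulN1r [X in - X]H ?opprB //.
  by move=> x; apply: cvgB; [apply: cvgM; [exact: cvg_cst|exact: continuous_sinX_cosX]|exact: cf].
have E : linform pole = mpolyX R (mnm1 2).
  rewrite /linform (bigD1 2) //= mxE !eqxx scale1r big1 ?addr0 // => i i2.
  by rewrite mxE (negPf i2) scale0r.
rewrite E mpolyXn sph_intX /longitude_integral /latitude_integral !mulmnE !mnm1E.
rewrite (_ : 2 == ord0 :> 'I_3 = false) // (_ : 2 == inord 1 :> 'I_3 = false); last first.
  by apply/eqP => /(congr1 val); rewrite /= inordK.
rewrite (_ : 2 == inord 2 :> 'I_3); last by apply/eqP/val_inj; rewrite /= inordK.
rewrite !mul0n mul1n.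
have pi20 : (0 : R) < 2 * pi by rewrite mulr_gt0 // pi_gt0.
have -> : trig_integral 0 (2 * pi) 0 0 = 2 * pi :> R.
  rewrite /trig_integral; under eq_Rintegral do rewrite !expr0 mul1r.
  by rewrite Rintegral_cst //= lebesgue_measure_itv /= lte_fin pi20 /= oppr0 addr0 mul1r.
by congr (_ * _); apply: (mulfI j0); rewrite I1 I2.
Qed.

Definition pole_poly p : mpoly 3 R := \sum_(j < size p) p`_j *: linform pole ^+ j.

Lemma ev_pole_poly p x : ev (pole_poly p) x = p.[dotv x pole].
Proof.
rewrite horner_coef /ev linear_sum; apply: eq_bigr => j _.
by rewrite /= mevalZ rmorphXn /= -/(ev _ _) ev_linform.
Qed.

Lemma sph_int_pole_poly p :
  sph_int (pole_poly p) = 2 * pi * \int[mu]_(t in `[-1, 1]) p.[t].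
Proof.
rewrite Rintegral_poly_sum mulr_sumr [LHS]linear_sum; apply: eq_bigr => j _.
by rewrite linearZ /= sph_int_pole_exp mulrCA.
Qed.

(** On the sphere one factor is taken as the zonal harmonic of degree l, the other as a polynomial
    in x.pole of degree m. For m < l all its powers integrate to 0; for m = l the reproducing
    property gives P_l(1) = 1 times the constant. *)
Lemma legendre_orth_le l m : (m <= l)%N ->
  \int[mu]_(t in `[-1, 1]) ((legendre R l).[t] * (legendre R m).[t]) =
  (m == l)%:R * (2 / (2 * l + 1)%:R).
Proof.
move=> ml; have pi0 : 2 * pi != 0 :> R by rewrite mulf_neq0 // gt_eqF // pi_gt0.
apply: (mulfI pi0).
have -> : \int[mu]_(t in `[-1, 1]) ((legendre R l).[t] * (legendre R m).[t]) =
    \int[mu]_(t in `[-1, 1]) ((legendre R l * legendre R m).[t]).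
  by apply: eq_Rintegral => t _; rewrite hornerM.
rewrite -sph_int_pole_poly.
transitivity (sph_int (zonal l pole * legendre_linform m pole)).
  apply: eq_sphere_integral => x x1; rewrite ev_pole_poly hornerM.
  by rewrite [RHS]mevalM -/(ev _ _) -/(ev _ _) ev_zonal // ev_legendre_linform.
have [->|nml] := eqVneq m l.
  rewrite (sph_int_legendre pole1 (dhomog_zonal _ _)) ?laplacian_zonal ?pole1 //.
  by rewrite ev_zonal ?pole1 ?legendre_at1 /S2 /= ?pole1 //; ring.
rewrite mul0r mulr0 /legendre_linform mulr_sumr [LHS]linear_sum big1 // => j _.
have jl : (j < l)%N by rewrite (@leq_ltn_trans m) ?leq_ord // ltn_neqAle nml.
rewrite -scalerAr [LHS]linearZ /=.
rewrite (sph_int_mul_linform_exp pole1 (dhomog_zonal _ _)) ?laplacian_zonal ?pole1 //; last exact: ltnW.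
by rewrite ltn_eqF // mul0r mulr0.
Qed.

Lemma legendre_orth l m :
  \int[mu]_(t in `[-1, 1]) ((legendre R l).[t] * (legendre R m).[t]) =
  (m == l)%:R * (2 / (2 * l + 1)%:R).
Proof.
have [ml|lm] := leqP m l; first exact: legendre_orth_le.
under eq_Rintegral do rewrite mulrC.
by rewrite legendre_orth_le ?(ltnW lm) // [l == m]eq_sym; case: eqP => [->|_]; rewrite ?mul0r.
Qed.

(** The leading coefficient of P_n is nonzero, so subtracting a multiple of P_n lowers the
    degree. *)
Lemma legendre_span (L : {poly R} -> R) :
  (forall a p q, L (a *: p + q) = a * L p + L q) ->
  (forall l, L (legendre R l) = 0) -> forall p, L p = 0.
Proof.
move=> Llin L0 p; have [n] := ubnP (size p); elim: n p => // n IH p /ltnSE sp.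
case: n => [|n] in IH sp *.
  move: sp; rewrite leqn0 size_poly_eq0 => /eqP ->.
  by have := Llin 1 0 0; rewrite scaler0 addr0 mul1r; lra.
have Ln : (legendre R n)`_n != 0.
  have := lead_legendre R n; apply: contra_eq_neq => ->; rewrite mul0r eq_sym.
  by rewrite pnatr_eq0 -lt0n; apply: prodn_gt0 => i; rewrite addn1.
rewrite -[p](subrK ((p`_n / (legendre R n)`_n) *: legendre R n)) addrC Llin L0 mulr0 add0r.
apply: IH; rewrite ltnS; apply/leq_sizeP => j nj.
rewrite coefB coefZ; have [<-|nnj] := eqVneq n j; first by rewrite divfK ?subrr.
have nj' : (n < j)%N by rewrite ltn_neqAle nnj.
by rewrite (coef_legendre_gt R nj') mulr0 subr0 nth_default // (leq_trans sp).
Qed.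

End LegendreOrthogonality.

(** * The series of psi, kappa and kappa' *)

Section LegendreSeries.
Variable R : realType.
Local Notation mu := (@lebesgue_measure R).

Lemma Rintegral_dist_le (f g : R -> R) (a b e : R) : a < b ->
  continuous f -> continuous g -> (forall x, a <= x <= b -> `|f x - g x| <= e) ->
  `|\int[mu]_(x in `[a, b]) f x - \int[mu]_(x in `[a, b]) g x| <= e * (b - a).
Proof.
move=> ab cf cg fg.
have cfg : continuous (fun x => f x - g x).
  by move=> x; apply: cvgB; [exact: cf|exact: cg].
rewrite -RintegralB //; try exact: continuous_integrable_itvcc.
apply: le_trans (le_normr_Rintegral _ _) _ => //; first exact: continuous_integrable_itvcc.
apply: (@le_trans _ _ (\int[mu]_(x in `[a, b]) e)).
  apply: le_Rintegral => //.
  - by apply: continuous_integrable_itvcc => x; apply: cvg_norm; exact: cfg.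
  - exact/continuous_integrable_itvcc/cst_continuous.

by rewrite Rintegral_cst //= lebesgue_measure_itv /= lte_fin ab /=.
Qed.

Lemma eq0_norm_le_cvg0 (c : R) (r : nat -> R) m : r @ \oo --> 0 ->
  (forall n, (m <= n)%N -> `|c| <= r n) -> c = 0.
Proof.
move=> r0 cr; apply/eqP; rewrite -normr_le0 -(cvg_lim _ r0) //.
apply: limr_ge; first by apply/cvg_ex; exists 0.
by near=> n; apply: cr; near: n; exact: nbhs_infty_ge.
Unshelve. all: by end_near. Qed.

Variable psi : R -> R.
Hypothesis psi_cont : {within `[-1, 1], continuous psi}.
Hypothesis psi_sum :
  (\sum_(1 <= l <oo) (l%:R * `|legendre_coef psi l|)%:E < +oo)%E.
(** A hypothesis here because its proof, [legendre_bounds], goes through a basis [Y], of which this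
    section is independent. *)
Hypothesis legendre_le1 : forall l (t : R), -1 <= t <= 1 ->
  `|(legendre R l).[t]| <= 1 /\ `|(legendre R l)^`().[t]| <= (l * l.+1)%:R / 2.

Local Notation a := (legendre_coef psi).

(** The common majorant of the series of psi, of the series of kappa and of every entry of the
    matrix series. *)
Definition coef_bound l : R := (2 * l + 1)%:R / (4 * pi) * `|a l|.

Lemma pi4_gt0 : (0 : R) < 4 * pi. Proof. by rewrite mulr_gt0 // pi_gt0. Qed.

Lemma coef_bound_ge0 l : 0 <= coef_bound l.
Proof. by rewrite mulr_ge0 // addition_factor_ge0. Qed.

Lemma coef_bound_cvg : cvgn (series coef_bound).
Proof.
have c1 : cvgn (series (fun l => l%:R * `|a l|)).
  apply: nnseries_is_cvg => [l|]; first by rewrite mulr_ge0.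
  apply: le_lt_trans psi_sum; rewrite le_eqVlt; apply/orP; left; apply/eqP.
  congr (lim (_ @ \oo)); apply/funext => n.
  case: n => [|n]; first by rewrite !big_geq.
  by rewrite big_ltn // mul0r add0e.
rewrite -(is_cvg_series_restrict 1).
(* The constant 3 comes from 2l + 1 <= 3l for l >= 1; the term l = 0 has been cut off for that
   reason. *)
have : cvgn (series ((3 / (4 * pi)) *: (fun l => l%:R * `|a l|))) by exact: is_cvg_seriesZ.
rewrite -(is_cvg_series_restrict 1) => c2.
have := @nondecreasing_is_cvgn R (fun n => \sum_(1 <= k < n) coef_bound k); apply.
  move=> n m nm; have [n1|n1] := leqP 1 n; last first.
    by rewrite big_geq ?(ltnW n1) // sumr_ge0 // => k _; exact: coef_bound_ge0.
  rewrite (big_cat_nat _ nm) //= lerDl sumr_ge0 // => k _; exact: coef_bound_ge0.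
have [M HM] := cvg_has_ub c2.
exists M => _ [n _ <-].
apply: le_trans (le_trans (ler_norm _) (HM _ (ex_intro2 _ _ n I erefl))).
rewrite /= big_nat_cond [leRHS]big_nat_cond; apply: ler_sum => l /andP[/andP[l1 _] _].
rewrite /coef_bound -[leRHS]/(3 / (4 * pi) * (l%:R * `|a l|)) mulrA.
apply: ler_wpM2r => //; rewrite mulrAC ler_wpM2r // ?invr_ge0 ?(ltW pi4_gt0) //.
rewrite -natrM ler_nat; lia.
Qed.

Definition coef_tail n : R := limn (series coef_bound) - series coef_bound n.

Lemma coef_tail_cvg0 : coef_tail @ \oo --> 0.
Proof. exact: series_tail_cvg0 coef_bound_cvg. Qed.

Definition legendre_term (t : R) l : R :=
  (2 * l + 1)%:R / (4 * pi) * a l * (legendre R l).[t].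

Lemma legendre_term_le t l : -1 <= t <= 1 -> `|legendre_term t l| <= coef_bound l.
Proof.
move=> t1; rewrite /legendre_term normrM.
have [P1 _] := legendre_le1 l t1; apply: le_trans (ler_wpM2l _ P1) _ => //.
by rewrite mulr1 normrM ger0_norm // addition_factor_ge0.
Qed.

Lemma continuous_legendre_term n :
  continuous (fun t => series (legendre_term t) n).
Proof.
have -> : (fun t => series (legendre_term t) n) = horner (\sum_(0 <= l < n)
    ((2 * l + 1)%:R / (4 * pi) * a l) *: legendre R l).
  by apply/funext => t; rewrite /series /= horner_sum; apply: eq_bigr => l _; rewrite hornerZ.
exact: continuous_horner.
Qed.

(** Both psi and the sum of its series are continuous, the latter as a uniform limit. Their
    difference is orthogonal to every P_m, hence to every polynomial, and so it is 0. *)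
Lemma legendre_series_eq t : -1 <= t <= 1 ->
  psi t = limn (series (legendre_term t)).
Proof.
move=> t1.
have tb s := series_tail_bound (fun l => legendre_term_le l (clamp_itv s)) coef_bound_cvg.
pose F (s : R) : R := limn (series (legendre_term (clamp s))).
have cS n : continuous (fun s => series (legendre_term (clamp s)) n).
  move=> s.
  exact: continuous_comp (@continuous_clamp R s) (@continuous_legendre_term n (clamp s)).
have cF : continuous F.
  move=> s; apply: (@cvg_unif_approx _ _ _ _ _ _ (fun n s => series (legendre_term (clamp s)) n)
     _ (fun n => series (legendre_term (clamp s)) n) coef_tail).
  - by move=> n; apply: nearW => x; have [_] := tb x; apply.
  - by move=> n; exact: cS.
  - by move=> n; have [_] := tb s; apply.
  - exact: coef_tail_cvg0.
have cpsi := continuous_comp_clamp psi_cont.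
pose D (s : R) := psi (clamp s) - F s.
have cD : continuous D by move=> s; apply: cvgB; [exact: cpsi|exact: cF].
have cM (f : R -> R) (p : {poly R}) : continuous f -> continuous (fun s => f s * p.[s]).
  by move=> cf s; apply: cvgM; [exact: cf|exact: continuous_horner].
suff : D t = 0 by rewrite /D /F /= clamp_id //; lra.
apply: continuous_orthogonal_poly0 => //; apply: legendre_span.
  move=> c p q; rewrite -RintegralZl //; last exact/continuous_integrable_itvcc/cM.
  rewrite -RintegralD //; last 2 first.
  - apply: continuous_integrable_itvcc => s; apply: cvgM; first exact: cvg_cst.
    exact: cM.
  - exact/continuous_integrable_itvcc/cM.
  by apply: eq_Rintegral => s _; rewrite hornerD hornerZ; ring.
move=> m; have m11 : (-1 : R) < 1 by lra.
(* For n > m the partial sum contains the m-th term, so by orthogonality its integral against P_m is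
   a_m / (2 pi), the same as for psi. What remains is its distance to [F], at most [coef_tail n] on
   an interval of length 2. *)
apply: (@eq0_norm_le_cvg0 _ (fun n => coef_tail n * 2) m.+1).
  by rewrite -(mul0r 2); apply: cvgM; [exact: coef_tail_cvg0|exact: cvg_cst].
move=> n mn.
have E1 : \int[mu]_(s in `[-1, 1]) (D s * (legendre R m).[s]) =
    \int[mu]_(s in `[-1, 1]) (psi (clamp s) * (legendre R m).[s]) -
    \int[mu]_(s in `[-1, 1]) (F s * (legendre R m).[s]).
  rewrite -RintegralB //; try exact/continuous_integrable_itvcc/cM.
  by apply: eq_Rintegral => s _; rewrite mulrBl.
have E2 : \int[mu]_(s in `[-1, 1]) (psi (clamp s) * (legendre R m).[s]) =
    \int[mu]_(s in `[-1, 1]) (series (legendre_term (clamp s)) n * (legendre R m).[s]).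
  transitivity (a m / (2 * pi)).
    rewrite /legendre_coef mulrAC divff ?mul1r; last by rewrite mulf_neq0 // gt_eqF // pi_gt0.
    apply: eq_Rintegral => s; rewrite inE /= in_itv /= => s1.
    by rewrite clamp_id.
  transitivity (\int[mu]_(s in `[-1, 1]) (\sum_(0 <= l < n)
      ((2 * l + 1)%:R / (4 * pi) * a l * ((legendre R l).[s] * (legendre R m).[s])))).
    have ch l : continuous (fun s : R => (legendre R l).[s] * (legendre R m).[s]).
      by apply: cM; exact: continuous_horner.
    rewrite Rintegral_sum_continuous => [|l]; last first.
      by move=> s; apply: cvgM; [exact: cvg_cst|exact: ch].
    have Ol l : \int[mu]_(s in `[-1, 1]) ((2 * l + 1)%:R / (4 * pi) * a l *
        ((legendre R l).[s] * (legendre R m).[s])) =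
        (2 * l + 1)%:R / (4 * pi) * a l * ((m == l)%:R * (2 / (2 * l + 1)%:R)).
      by rewrite RintegralZl ?legendre_orth //; exact: (continuous_integrable_itvcc _ _ (@ch l)).
    under eq_bigr do rewrite Ol.
    rewrite big_mkord (bigD1 (Ordinal mn)) //= eqxx mul1r big1 ?addr0 => [|l lm]; last first.
      by rewrite [m == l]eq_sym -val_eqE /= in lm *; rewrite (negPf lm) mul0r mulr0.
    have p0 : pi != 0 :> R by rewrite gt_eqF // pi_gt0.
    have l0 : (2 * m + 1)%:R != 0 :> R by rewrite pnatr_eq0 addn1.
    by move: l0 p0; move: (_%:R) (pi) => x y x0 y0; field; rewrite x0 y0.
  apply: eq_Rintegral => s; rewrite inE /= in_itv /= => s1.
  rewrite clamp_id // /series /= mulr_suml; apply: eq_bigr => l _.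
  by rewrite /legendre_term mulrA.
rewrite E1 E2 distrC (_ : 2 = 1 - -1 :> R); last by ring.
apply: Rintegral_dist_le => //; try exact: cM.
move=> s s1; rewrite -mulrBl normrM.
have [P1 _] := legendre_le1 m s1.
have [_ /(_ n) T] := tb s; apply: le_trans (ler_wpM2l _ P1) _ => //.
by rewrite mulr1.
Qed.

Lemma legendre_tail_le t n : -1 <= t <= 1 ->
  `|psi t - series (legendre_term t) n| <= coef_tail n.
Proof.
move=> t1; rewrite legendre_series_eq //.
have [_] := series_tail_bound (fun l => legendre_term_le l t1) coef_bound_cvg; exact.
Qed.

(** At l = 0 the inverse of 0 is 0, so the term vanishes and sums may start at 0. *)
Definition kappa_term (t : R) l : R :=
  (2 * l + 1)%:R / (4 * pi) / (l * l.+1)%:R * a l * (legendre R l)^`().[t].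

Lemma kappa_term_le t l : -1 <= t <= 1 -> `|kappa_term t l| <= coef_bound l.
Proof.
move=> t1; have [_ P1] := legendre_le1 l t1.
have [->|l0] := posnP l.
  by rewrite /kappa_term mul0n invr0 mulr0 !mul0r normr0 coef_bound_ge0.
have ll0 : 0 < (l * l.+1)%:R :> R by rewrite ltr0n muln_gt0 l0.
rewrite (_ : kappa_term t l = (2 * l + 1)%:R / (4 * pi) * a l *
    ((legendre R l)^`().[t] / (l * l.+1)%:R)); last by rewrite /kappa_term; ring.
rewrite normrM [`|_ * a l|]normrM (ger0_norm (addition_factor_ge0 R l)).
rewrite [`|_ / (l * l.+1)%:R|]normrM [`|_^-1|]gtr0_norm ?invr_gt0 // -/(coef_bound l).
rewrite ler_piMr ?coef_bound_ge0 // ler_pdivrMr // mul1r.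
by apply: le_trans P1 _; rewrite ler_pdivrMr // ler_peMr // ?ltW //; lra.
Qed.

(** Legendre's equation in the form ((1 - t^2) P_l')' = -l(l+1) P_l provides a primitive, and the
    factor 1 - t^2 removes the boundary term at -1. *)
Lemma Rintegral_legendre l (t : R) : (0 < l)%N -> -1 < t ->
  \int[mu]_(s in `[-1, t]) (legendre R l).[s] =
  - ((1 - t ^+ 2) * (legendre R l)^`().[t] / (l * l.+1)%:R).
Proof.
move=> l0 t1; have ll0 : (l * l.+1)%:R != 0 :> R by rewrite pnatr_eq0 muln_eq0 negb_or -lt0n l0.
pose p : {poly R} := (- (l * l.+1)%:R^-1) *: ((1 - 'X ^+ 2) * (legendre R l)^`()).
have pE : p^`() = legendre R l.
  rewrite /p derivZ derivM legendre_ode derivB derivXn -polyC1 derivC sub0r /= expr1.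
  rewrite mulNr mulrnAl addrA addNr sub0r scaleNr scalerN opprK.
  by rewrite -[X in _ *: X]scaler_nat scalerA mulVf // scale1r.
have := Rintegral_deriv_poly p t1; rewrite pE => ->; rewrite /p !(hornerE, hornerXn) /=; ring.
Qed.

Hypothesis psi_0 : a 0 = 1.

(** The normalization [a 0 = 1] makes the term l = 0 cancel the constant 1; the index [n.+1] ensures
    that this term is present. The factor left over is the one that the definition of kappa divides
    by. *)
Lemma Rintegral_legendre_term n (t : R) : -1 < t ->
  \int[mu]_(s in `[-1, t]) (1 - 4 * pi * series (legendre_term s) n.+1) =
  4 * pi * (1 - t ^+ 2) * series (kappa_term t) n.+1.
Proof.
move=> t1; have p0 : pi != 0 :> R by rewrite gt_eqF // pi_gt0.
transitivity (\int[mu]_(s in `[-1, t]) \sum_(1 <= l < n.+1)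
    (- (4 * pi) * ((2 * l + 1)%:R / (4 * pi) * a l) * (legendre R l).[s])).
  apply: eq_Rintegral => s _; rewrite /series /= big_ltn //.
  rewrite /legendre_term psi_0 [legendre R 0]/legendre expn0 fact0 invr1 scale1r expr0 derivn0.
  rewrite -polyC1 hornerC muln0 add0n mulrDr opprD addrA.
  rewrite (_ : 1 - 4 * pi * (1 / (4 * pi) * 1 * 1) = 0) ?sub0r; last first.
    by rewrite !mulr1 mul1r mulfV ?subrr ?mulf_neq0.
  by rewrite -mulNr mulr_sumr; apply: eq_bigr => l _; rewrite mulrA.
have cl l : continuous (fun s : R => (legendre R l).[s]) by exact: continuous_horner.
rewrite Rintegral_sum_continuous => [|l]; last first.
  by move=> s; apply: cvgM; [exact: cvg_cst|exact: cl].
rewrite /series /= [in RHS]big_ltn // (_ : kappa_term t 0 = 0) ?add0r; last first.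
  by rewrite /kappa_term mul0n invr0 mulr0 !mul0r.
rewrite mulr_sumr; apply: eq_big_nat => l /andP[l0 _].
rewrite RintegralZl //; last exact: (continuous_integrable_itvcc _ _ (@cl l)).
by rewrite Rintegral_legendre // /kappa_term; ring.
Qed.

Lemma kappaE t : -1 < t < 1 -> kappa psi t = (4 * pi * (1 - t ^+ 2))^-1 *
  \int[mu]_(s in `[-1, t]) (1 - 4 * pi * psi (clamp s)).
Proof.
move=> t1; rewrite /kappa /cont_ext mem_set; last by rewrite /= in_itv.
congr (_ * _); apply: eq_Rintegral => s; rewrite inE /= in_itv /= => /andP[s1 s2].
by rewrite clamp_id // s1 (le_trans s2) //; case/andP: t1 => _ /ltW.
Qed.

Lemma continuous_one_sub_psi : continuous (fun s : R => 1 - 4 * pi * psi (clamp s)).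
Proof.
have cp := continuous_comp_clamp psi_cont.
move=> s; apply: cvgB; first exact: cvg_cst.
by apply: cvgM; [exact: cvg_cst|exact: cp].
Qed.

Lemma onem_sqr_gt0 (t : R) : -1 < t < 1 -> 0 < 1 - t ^+ 2.
Proof. by move=> /andP[? ?]; nra. Qed.

Lemma kappa_series t : -1 < t < 1 -> series (kappa_term t) @ \oo --> kappa psi t.
Proof.
move=> t1; have t1' : -1 <= t <= 1 by case/andP: t1 => /ltW -> /ltW ->.
have [ck _] := series_tail_bound (fun l => kappa_term_le l t1') coef_bound_cvg.
rewrite kappaE //; set G := Rintegral _ _ _.
have w0 : 4 * pi * (1 - t ^+ 2) != 0.
  by rewrite mulf_neq0 // gt_eqF //; [exact: pi4_gt0|exact: onem_sqr_gt0].
suff -> : G = 4 * pi * (1 - t ^+ 2) * limn (series (kappa_term t)) by rewrite mulKf.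
have H : (fun n => 4 * pi * (1 - t ^+ 2) * series (kappa_term t) n.+1) @ \oo -->
    4 * pi * (1 - t ^+ 2) * limn (series (kappa_term t)).
  by apply: cvgM; [exact: cvg_cst|rewrite (cvg_shiftS (series (kappa_term t)))].
have HG : (fun n => 4 * pi * (1 - t ^+ 2) * series (kappa_term t) n.+1) @ \oo --> G.
  apply: (@cvg_dist_le _ _ _ _ (fun n => 4 * pi * coef_tail n.+1 * (t - -1))).
    move=> n; rewrite -Rintegral_legendre_term; last by case/andP: t1.
    apply: Rintegral_dist_le; first by case/andP: t1.
    - exact: continuous_one_sub_psi.
    - move=> s; apply: cvgB; first exact: cvg_cst.
      by apply: cvgM; [exact: cvg_cst|exact: continuous_legendre_term].
    move=> s /andP[s1 s2].
    have s11 : -1 <= s <= 1 by rewrite s1 (le_trans s2) //; case/andP: t1'.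
    rewrite clamp_id // opprB addrC addrA subrK -mulrBr normrM (gtr0_norm pi4_gt0).
    by rewrite ler_pM2l ?pi4_gt0 // distrC legendre_tail_le.
  rewrite -(mul0r (t - -1)) -[X in X * (t - -1)](mulr0 (4 * pi)).
  apply: cvgM; last exact: cvg_cst.
  by apply: cvgM; [exact: cvg_cst|rewrite (cvg_shiftS coef_tail); exact: coef_tail_cvg0].
exact: cvg_unique HG H.
Qed.

Definition kappa'_term (t : R) l : R :=
  (2 * l + 1)%:R / (4 * pi) / (l * l.+1)%:R * a l * (legendre R l)^`()^`().[t].

(** This is (w kappa)' = 1 - 4 pi psi with w(t) = 4 pi (1 - t^2), divided by 4 pi. *)
Lemma derive_kappa t : -1 < t < 1 ->
  (1 - t ^+ 2) * derive1 (kappa psi) t =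
  2 * t * kappa psi t + (1 - 4 * pi * psi t) / (4 * pi).
Proof.
move=> t1; have t11 : -1 <= t <= 1 by case/andP: t1 => /ltW -> /ltW ->.
pose f s : R := 1 - 4 * pi * psi (clamp s).
pose G s : R := \int[mu]_(x in `[-1, s]) f x.
have [dG GE] : derivable G t 1 /\ derive1 G t = f t.
  case/andP: t1 => t0 t1; apply: (@continuous_FTC1_closed _ f (-1) t 1 t1) => //.
  - exact: continuous_integrable_itvcc continuous_one_sub_psi.
  - exact: continuous_one_sub_psi.
have dG' : is_derive t (1 : R) G (f t) by apply: DeriveDef; [exact: dG|rewrite -derive1E].
pose w : {poly R} := (4 * pi) *: (1 - 'X ^+ 2).
have wE s : w.[s] = 4 * pi * (1 - s ^+ 2) by rewrite !(hornerE, hornerXn).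
have w0 : w.[t] != 0.
  by rewrite wE mulf_neq0 // gt_eqF //; [exact: pi4_gt0|exact: onem_sqr_gt0].
have dw := is_deriveV w0 (horner_is_derive w t).
have dk := is_deriveM dw dG'.
have kE : {near t, kappa psi =1 (fun s => (w.[s])^-1) * G}.
  have := near_in_itvoo t1; apply: filterS => s; rewrite in_itv /= => s1.
  by rewrite kappaE // -wE.
have E : derive1 (kappa psi) t =
    (w.[t])^-1 * f t + G t * (- w.[t] ^- 2 * w^`()%R.[t]).
  rewrite derive1E (near_eq_derive _ kE).
  exact: (@derive_val _ _ _ _ _ _ _ dk).
have w'E : w^`()%R.[t] = - (8 * pi * t).
  rewrite /w derivZ derivB derivXn -polyC1 derivC sub0r /= expr1.
  by rewrite hornerZ hornerN hornerMn hornerX; ring.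
rewrite E w'E kappaE // -wE -[\int[_]_(_ in _) _]/(G t) /f clamp_id //.
have u0 : 1 - t ^+ 2 != 0 by rewrite gt_eqF // onem_sqr_gt0.
have p0 : pi != 0 :> R by rewrite gt_eqF // pi_gt0.
rewrite wE; move: (G t) (psi t) => g q.
by move: (pi) p0 => y y0; field; rewrite y0 u0.
Qed.

(** For l >= 1 Legendre's equation relates the l-th terms of the series of kappa', kappa and psi
    exactly as [derive_kappa] relates the functions. The constant 1/(4 pi) there is the term l = 0
    of the series of psi. Convergence thus follows from that of the other two series. *)
Lemma derive_kappa_series t : -1 < t < 1 ->
  series (kappa'_term t) @ \oo --> derive1 (kappa psi) t.
Proof.
move=> t1; have t11 : -1 <= t <= 1 by case/andP: t1 => /ltW -> /ltW ->.
have u0 : 1 - t ^+ 2 != 0 by rewrite gt_eqF // onem_sqr_gt0.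
have p0 : pi != 0 :> R by rewrite gt_eqF // pi_gt0.
have step l : (0 < l)%N -> kappa'_term t l =
    (1 - t ^+ 2)^-1 * (2 * t * kappa_term t l - legendre_term t l).
  move=> l0; suff E : (1 - t ^+ 2) * kappa'_term t l =
    2 * t * kappa_term t l - legendre_term t l by rewrite -E mulKf.
  have ode := congr1 (horner ^~ t) (legendre_ode R l).
  rewrite !(hornerE, hornerXn) !hornerMn in ode.
  have ll0 : (l * l.+1)%:R != 0 :> R by rewrite pnatr_eq0 muln_eq0 negb_or -lt0n l0.
  have LE : legendre_term t l = (2 * l + 1)%:R / (4 * pi) / (l * l.+1)%:R * a l *
      ((l * l.+1)%:R * (legendre R l).[t]).
    rewrite /legendre_term; move: (a l) ll0 => x; move: ((l * l.+1)%:R) => z z0.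
    by move: (pi) p0 => y y0; field; rewrite y0 z0.
  rewrite LE /kappa'_term /kappa_term; set c := _ * a l; clearbody c.
  transitivity (c * ((1 - t ^+ 2) * (legendre R l)^`()^`().[t])); first by ring.
  by rewrite ode -mulr_natl; ring.
have k0 s : kappa_term s 0 = 0 by rewrite /kappa_term mul0n invr0 mulr0 !mul0r.
have k'0 s : kappa'_term s 0 = 0 by rewrite /kappa'_term mul0n invr0 mulr0 !mul0r.
have l0 : legendre_term t 0 = (4 * pi)^-1.
  rewrite /legendre_term psi_0 /legendre expn0 fact0 invr1 scale1r expr0 derivn0.
  by rewrite -polyC1 hornerC muln0 add0n mul1r !mulr1.
have sE n : series (kappa'_term t) n.+1 = (1 - t ^+ 2)^-1 *
    (2 * t * series (kappa_term t) n.+1 - (series (legendre_term t) n.+1 - (4 * pi)^-1)).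
  rewrite /series /= big_ltn // [\sum_(0 <= k < n.+1) kappa_term t k]big_ltn //.
  rewrite [\sum_(0 <= k < n.+1) legendre_term t k]big_ltn // k0 k'0 !add0r l0.
  rewrite [(4 * pi)^-1 + _]addrC addrK mulr_sumr -sumrB mulr_sumr.
  by apply: eq_big_nat => l /andP[l1 _]; exact: step.
have H : (fun n => (1 - t ^+ 2)^-1 * (2 * t * series (kappa_term t) n.+1 -
     (series (legendre_term t) n.+1 - (4 * pi)^-1))) @ \oo -->
   (1 - t ^+ 2)^-1 * (2 * t * kappa psi t - (psi t - (4 * pi)^-1)).
  apply: cvgM; first exact: cvg_cst.
  apply: cvgB.
    apply: cvgM; first exact: cvg_cst.
    by rewrite (cvg_shiftS (series (kappa_term t))); exact: kappa_series.
  apply: cvgB; last exact: cvg_cst.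
  rewrite (cvg_shiftS (series (legendre_term t))).
  apply: (@cvg_dist_le _ _ _ _ coef_tail); last exact: coef_tail_cvg0.
  by move=> n; exact: legendre_tail_le.
rewrite -(cvg_shiftS (series (kappa'_term t))) (funext sE).
suff -> : derive1 (kappa psi) t =
   (1 - t ^+ 2)^-1 * (2 * t * kappa psi t - (psi t - (4 * pi)^-1)) by [].
apply: (mulfI u0); rewrite derive_kappa // mulVKf //.
by move: (psi t) (kappa psi t) => x k; move: (pi) p0 => y y0; field.
Qed.

End LegendreSeries.

(** * Convergence of matrices from their entries *)

Section MatrixConvergence.
Variable R : realType.

Lemma mx_norm_le (m n : nat) (M : 'M[R]_(m.+1, n.+1)) (c : R) :
  0 <= c -> (forall i j, `|M i j| <= c) -> `|M| <= c.
Proof.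
move=> c0 Mc; rewrite /Num.Def.normr /= mx_normrE.
by apply/bigmax_leP; split => // -[i j] _; exact: Mc.
Qed.

Lemma cvg_mx (T : Type) (F : set_system T) (FF : Filter F) (m n : nat)
    (M : T -> 'M[R]_(m.+1, n.+1)) (L : 'M[R]_(m.+1, n.+1)) :
  (forall i j, M x i j @[x --> F] --> L i j) -> M x @[x --> F] --> L.
Proof.
move=> ML; apply/cvgrPdist_le => e e0.
have : \forall x \near F, forall ij : 'I_m.+1 * 'I_n.+1, `|L ij.1 ij.2 - M x ij.1 ij.2| <= e.
  by apply: filter_forall => -[i j]; have /cvgrPdist_le := ML i j; exact.
apply: filterS => x H; apply: mx_norm_le (ltW e0) _ => i j.
by rewrite !mxE; exact: (H (i, j)).
Qed.

Lemma cvg_uniform_dist_le (V : normedModType R) (T : choiceType) (D : set T)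
    (fn : nat -> T -> V) (f : T -> V) (r : nat -> R) :
  (forall n p, D p -> `|f p - fn n p| <= r n) -> r @ \oo --> 0 ->
  {uniform D, fn @ \oo --> f}.
Proof.
move=> fr r0 P /uniform_nbhs[E [entE EP]].
have [e /= e0 He] : exists2 e : R, 0 < e & [set xy | `|xy.1 - xy.2| < e] `<=` E.
  by move: entE; rewrite -entourage_ballE => -[e /= e0 He]; exists e => // xy /= H;
     apply: He; rewrite /= -ball_normE.
have /cvgrPdist_lt /(_ _ e0) := r0; apply: filterS => n /=.
rewrite sub0r normrN => rn; apply: EP => p Dp; apply: He => /=.
by apply: le_lt_trans (fr n p Dp) _; exact: le_lt_trans (ler_norm _) rn.
Qed.

End MatrixConvergence.

(** * Generic pairs, and approach to the pairs with x = y or x = -y *)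

Section GenericPairs.
Variable R : realType.
Implicit Types x y v : 'cV[R]_3.

Lemma dotvNr x y : dotv x (- y) = - dotv x y.
Proof. by rewrite -scaleN1r dotvZr mulN1r. Qed.

Lemma dotvNl x y : dotv (- x) y = - dotv x y.
Proof. by rewrite dotvC dotvNr dotvC. Qed.

(** From |x - z|^2 = 2 - 2 x.z > 0, applied to z = y and z = -y. *)
Lemma generic_dotv x y : generic_pairs (x, y) -> -1 < dotv x y < 1.
Proof.
move=> [/= x1 y1 xy xNy].
have D z : S2 z -> x <> z -> dotv x z < 1.
  move=> z1 xz; have : dotv (x - z) (x - z) != 0.
    by apply/eqP => /dotv_eq0 /eqP; rewrite subr_eq0 => /eqP.
  have := dotv_ge0 (x - z); rewrite le_eqVlt => /orP[/eqP <-|]; first by rewrite eqxx.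
  rewrite dotvDl !dotvDr !dotvNr !dotvNl [dotv z x]dotvC.
  rewrite (x1 : dotv x x = 1) (z1 : dotv z z = 1); lra.
have Ny1 : S2 (- y) by rewrite /S2 /= dotvNr dotvC dotvNr opprK.
by rewrite (D y y1 xy) andbT; have := D _ Ny1 xNy; rewrite dotvNr; lra.
Qed.

(** Some e_i × x is nonzero: the squared lengths of these vectors are the diagonal entries of
    R(x,x), whose trace is 2. *)
Lemma orthogonal_unit x : S2 x -> exists v, dotv x v = 0 /\ dotv v v = 1.
Proof.
move=> x1.
have [i ni] : exists i, dotv (curl_dir i x) (curl_dir i x) != 0.
  apply: contrapT => /forallNP H.
  have H0 i : matR x x i i = 0.
    by rewrite matRE; apply/eqP; have /negP := H i; rewrite negbK.
  have : \sum_i matR x x i i = 0 by apply: big1 => i _.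
  have : dotv x x = 1 by exact: x1.
  rewrite dotvE !sum3 /matR !mxE !big_ord1 !mxE /= (x1 : dotv x x = 1); lra.
set w := curl_dir i x in ni; pose r := Num.sqrt (dotv w w).
have r2 : r ^+ 2 = dotv w w by rewrite sqr_sqrtr ?dotv_ge0.
have r0 : r != 0 by apply: contra ni => /eqP r0; rewrite -r2 r0 expr0n.
exists (r^-1 *: w); rewrite !dotvZr curl_dir_orth mulr0 dotvZl -r2; split=> //.
by field.
Qed.

(** Limits along generic pairs are unique only if such pairs come arbitrarily close. Here y is moved
    along a great circle by a small angle s in (0, pi), in a direction v orthogonal to x: then v.(c
    s) = sin s > 0 while v.x = 0, so c s is neither x nor -x. *)
Lemma generic_pairs_limit x y : S2 x -> S2 y -> x = y \/ x = - y ->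
  ProperFilter (within (@generic_pairs R) (nbhs (x, y))).
Proof.
move=> x1 y1 xy; apply: Build_ProperFilter_ex => A HA.
have [v [xv v1]] := orthogonal_unit x1.
have yv : dotv y v = 0.
  by case: xy => [<- //|xN]; move: xv; rewrite xN dotvC dotvNr dotvC => /eqP; rewrite oppr_eq0 => /eqP.
pose c (s : R) : 'cV[R]_3 := cos s *: y + sin s *: v.
have c1 s : S2 (c s).
  rewrite /S2 /= /c dotvDl !dotvDr !dotvZl !dotvZr [dotv v y]dotvC yv v1.
  by rewrite (y1 : dotv y y = 1); rewrite -[RHS](cos2Dsin2 s); ring.
have cc : c s @[s --> (0 : R)] --> y.
  have -> : y = cos 0 *: y + sin 0 *: v :> 'cV[R]_3.
    by rewrite cos0 sin0 scale1r scale0r addr0.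
  by apply: cvgD; apply: cvgZr_tmp; [exact: continuous_cos|exact: continuous_sin].
have [[U V] /= [Ux Vy] UV] := HA.
have [e /= e0 He] := cc _ Vy.
pose s := Num.min (e / 2) 1.
have s0 : 0 < s by rewrite lt_min ltr01 andbT divr_gt0.
have se : s < e by rewrite gt_min; apply/orP; left; lra.
have sp : s < pi.
  by apply: (@lt_le_trans _ _ 2); [rewrite gt_min; apply/orP; right; lra|exact: pi_ge2].
have ss : 0 < sin s by apply: sin_gt0_pi; rewrite s0.
have vc : dotv v (c s) = sin s by rewrite /c dotvDr !dotvZr [dotv v y]dotvC yv v1; ring.
exists (x, c s); apply: (UV (x, c s)).
  split => /=; first exact: nbhs_singleton.
  by apply: He; rewrite /= sub0r normrN gtr0_norm.
split => //= E.
  by move: vc; rewrite -E dotvC xv => vc; rewrite -vc ltxx in ss.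
by move: xv; rewrite E dotvC dotvNr vc => /eqP; rewrite oppr_eq0 => /eqP s00; rewrite s00 ltxx in ss.
Qed.

End GenericPairs.

(** * Continuity of the entries of Q, R, V and W *)

Section KernelContinuity.
Variable R : realType.
Local Notation V2 := ('cV[R]_3 * 'cV[R]_3)%type.
Implicit Types p : V2.

Lemma continuous_coord1 i : continuous (fun p => p.1 i 0).
Proof.
move=> p; apply: (@continuous_comp _ _ _ fst (fun x : 'cV[R]_3 => x i 0)).
  exact: cvg_fst.
exact: coord_continuous.
Qed.

Lemma continuous_coord2 i : continuous (fun p => p.2 i 0).
Proof.
move=> p; apply: (@continuous_comp _ _ _ snd (fun x : 'cV[R]_3 => x i 0)).
  exact: cvg_snd.
exact: coord_continuous.
Qed.

Lemma continuous_mul2 (f g : V2 -> R) : continuous f -> continuous g ->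
  continuous (fun p => f p * g p).
Proof. by move=> cf cg p; apply: cvgM; [exact: cf|exact: cg]. Qed.

Lemma continuous_sub2 (f g : V2 -> R) : continuous f -> continuous g ->
  continuous (fun p => f p - g p).
Proof. by move=> cf cg p; apply: cvgB; [exact: cf|exact: cg]. Qed.

Lemma continuous_sum3 (f : 'I_3 -> V2 -> R) : (forall i, continuous (f i)) ->
  continuous (fun p => \sum_(i < 3) f i p).
Proof.
move=> cf; have -> : (fun p => \sum_(i < 3) f i p) =
    fun p => f 0 p + f 1 p + f 2 p by apply/funext => p; rewrite sum3.
by move=> p; apply: cvgD; [apply: cvgD|]; exact: cf.
Qed.

Lemma continuous_dotv : continuous (fun p : V2 => dotv p.1 p.2).
Proof.
apply: continuous_sum3 => i; apply: continuous_mul2.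
  exact: continuous_coord1.
exact: continuous_coord2.
Qed.

Lemma continuous_crossv i : continuous (fun p : V2 => crossv p.1 p.2 i 0).
Proof.
have -> : (fun p : V2 => crossv p.1 p.2 i 0) = fun p =>
    p.1 (i + 1) 0 * p.2 (i + 2) 0 - p.1 (i + 2) 0 * p.2 (i + 1) 0.
  by apply/funext => p; rewrite mxE.
apply: continuous_sub2; apply: continuous_mul2;
  by [exact: continuous_coord1|exact: continuous_coord2].
Qed.

Lemma continuous_matQ i j : continuous (fun p : V2 => matQ p.1 p.2 i j).
Proof.
have -> : (fun p : V2 => matQ p.1 p.2 i j) = fun p =>
    0 - crossv p.1 p.2 i 0 * crossv p.1 p.2 j 0.
  by apply/funext => p; rewrite mxE mxE big_ord1 [_^T _ _]mxE sub0r.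
apply: continuous_sub2; first exact: cst_continuous.
by apply: continuous_mul2; exact: continuous_crossv.
Qed.

Lemma continuous_matR i j : continuous (fun p : V2 => matR p.1 p.2 i j).
Proof.
have -> : (fun p : V2 => matR p.1 p.2 i j) = fun p =>
    dotv p.1 p.2 * (i == j)%:R - p.2 i 0 * p.1 j 0.
  by apply/funext => p; rewrite !mxE big_ord1 !mxE mulr_natr.
apply: continuous_sub2; apply: continuous_mul2.
- exact: continuous_dotv.
- exact: cst_continuous.
- exact: continuous_coord2.
- exact: continuous_coord1.
Qed.

Lemma continuous_matV i j : continuous (fun p : V2 => matV p.1 p.2 i j).
Proof.
have -> : (fun p : V2 => matV p.1 p.2 i j) = fun p =>
    (p.2 i 0 - dotv p.1 p.2 * p.1 i 0) * (p.1 j 0 - dotv p.1 p.2 * p.2 j 0).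
  by apply/funext => p; rewrite !mxE big_ord1 !mxE.
apply: continuous_mul2; apply: continuous_sub2;
  try (by [exact: continuous_coord1|exact: continuous_coord2]);
  apply: continuous_mul2; try exact: continuous_dotv;
  by [exact: continuous_coord1|exact: continuous_coord2].
Qed.

Lemma continuous_matW i j : continuous (fun p : V2 => matW p.1 p.2 i j).
Proof.
have -> : (fun p : V2 => matW p.1 p.2 i j) = fun p => \sum_(k < 3)
    ((i == k)%:R - p.1 i 0 * p.1 k 0) * ((k == j)%:R - p.2 k 0 * p.2 j 0).
  apply/funext => p; rewrite mxE; apply: eq_bigr => k _.
  by rewrite !mxE !big_ord1 !mxE.
apply: continuous_sum3 => k; apply: continuous_mul2; apply: continuous_sub2;
  try exact: cst_continuous; apply: continuous_mul2;
  by [exact: continuous_coord1|exact: continuous_coord2].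
Qed.

End KernelContinuity.

(** * The expansion for an abstract kernel, covering both cases *)

Section KernelExpansion.
Variable R : realType.
Variable psi : R -> R.
Hypothesis psi_cont : {within `[-1, 1], continuous psi}.
Hypothesis psi_sum :
  (\sum_(1 <= l <oo) (l%:R * `|legendre_coef psi l|)%:E < +oo)%E.
Hypothesis legendre_le1 : forall l (t : R), -1 <= t <= 1 ->
  `|(legendre R l).[t]| <= 1 /\ `|(legendre R l)^`().[t]| <= (l * l.+1)%:R / 2.
Hypothesis psi_0 : legendre_coef psi 0 = 1.

Local Notation V2 := ('cV[R]_3 * 'cV[R]_3)%type.
Local Notation SS := (@S2 R `*` @S2 R).

(** [A] stands for the terms of the series and [F] for the closed formula; [q], [r] are the entries
    of Q, R or of V, W. The bound [A_le] concerns whole entries, because the part with [kappa'_term]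
    alone has no such bound near t = 1 and t = -1. *)
Variables (A : nat -> V2 -> 'M[R]_3) (F : V2 -> 'M[R]_3).
Variables q r : 'I_3 -> 'I_3 -> V2 -> R.
Hypothesis q_cont : forall i j, continuous (q i j).
Hypothesis r_cont : forall i j, continuous (r i j).
Hypothesis AE : forall l p i j, SS p -> A l p i j =
  kappa'_term psi (dotv p.1 p.2) l * q i j p +
  kappa_term psi (dotv p.1 p.2) l * r i j p.
Hypothesis A_le : forall l p i j, SS p -> `|A l p i j| <= coef_bound psi l.
Hypothesis FE : forall p i j, F p i j =
  derive1 (kappa psi) (dotv p.1 p.2) * q i j p + kappa psi (dotv p.1 p.2) * r i j p.

Let S p : 'M[R]_3 := \matrix_(i, j) limn (series (fun l => A l p i j)).

Let A0 p : SS p -> A 0 p = 0.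
Proof.
move=> Sp; apply/matrixP => i j; rewrite AE // mxE /kappa'_term /kappa_term.
by rewrite mul0n invr0 mulr0 !mul0r addr0.
Qed.

Let cb := coef_bound_cvg psi_sum.

Let partial_sumE n p i j : SS p ->
  (\sum_(1 <= l < n) A l p) i j = series (fun l => A l p i j) n.
Proof. by move=> Sp; rewrite summxE sum1_series // A0 // mxE. Qed.

Let S_dist n p : SS p -> `|S p - \sum_(1 <= l < n) A l p| <= coef_tail psi n.
Proof.
move=> Sp; have [_ T] := series_tail_bound (fun l => A_le l 0 0 Sp) cb.
apply: mx_norm_le => [|i j]; first exact: le_trans (T n).
have [_ {}T] := series_tail_bound (fun l => A_le l i j Sp) cb.
by rewrite mxE [X in _ + X]mxE partial_sumE // mxE; exact: T.
Qed.

Let cvgS p : SS p -> (fun n => \sum_(1 <= l < n) A l p) @ \oo --> S p.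
Proof.
move=> Sp; apply: (@cvg_dist_le _ _ _ _ (coef_tail psi)) => [n|].
  exact: S_dist.
exact: coef_tail_cvg0.
Qed.

Let limS p : SS p -> limn (fun n => \sum_(1 <= l < n) A l p) = S p.
Proof. by move=> Sp; apply: cvg_lim => //; exact: cvgS. Qed.

Lemma kernel_generic p : generic_pairs p ->
  F p = limn (fun n => \sum_(1 <= l < n) A l p).
Proof.
case: p => x y gp; have [/= x1 y1 _ _] := gp.
have Sp : SS (x, y) by [].
have t1 := generic_dotv gp.
rewrite limS //; apply/matrixP => i j; rewrite FE mxE; apply/esym/cvg_lim => //.
have -> : series (fun l => A l (x, y) i j) = fun n =>
    series (kappa'_term psi (dotv x y)) n * q i j (x, y) +
    series (kappa_term psi (dotv x y)) n * r i j (x, y).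
  apply/funext => n; rewrite /series /= !mulr_suml -big_split /=.
  by apply: eq_bigr => l _; rewrite AE.
apply: cvgD; apply: cvgM; try exact: cvg_cst.
  exact: derive_kappa_series.
exact: kappa_series.
Qed.

(** On the sphere a finite sum agrees with [g], which is built from polynomials in x.y and is
    continuous everywhere, also at x = y and x = -y. *)
Let partial_cvg n p : SS p ->
  (\sum_(1 <= l < n) A l p') @[p' --> within (@generic_pairs R) (nbhs p)] -->
  \sum_(1 <= l < n) A l p.
Proof.
move=> Sp; apply: cvg_mx => i j.
pose g p' := \sum_(1 <= l < n) (kappa'_term psi (dotv p'.1 p'.2) l * q i j p' +
  kappa_term psi (dotv p'.1 p'.2) l * r i j p').
have gE p' : SS p' -> (\sum_(1 <= l < n) A l p') i j = g p'.
  by move=> Sp'; rewrite summxE; apply: eq_bigr => l _; rewrite AE.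
rewrite gE //; apply: (@cvg_trans _ (g @ within (@generic_pairs R) (nbhs p))).
  apply: near_eq_cvg; apply: filterS (withinT (@generic_pairs R) (nbhs_filter p)).
  by move=> p' [? ? _ _]; rewrite gE.
apply: cvg_within_filter.
have cP (P : {poly R}) : continuous (fun p : V2 => P.[dotv p.1 p.2]).
  move=> p'; apply: (@continuous_comp _ _ _ (fun p : V2 => dotv p.1 p.2) (horner P)).
    exact: continuous_dotv.
  exact: continuous_horner.
apply: cvg_big => [|l _]; first exact: add_continuous.
have ck (c : R) (P : {poly R}) (f : V2 -> R) : continuous f ->
    continuous (fun p : V2 => c * P.[dotv p.1 p.2] * f p).
  by move=> cf p'; apply: cvgM; [apply: cvgM; [exact: cvg_cst|exact: cP]|exact: cf].
by apply: cvgD; exact: ck.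
Qed.

(** Near p the formula is the sum of the series at generic pairs, with a tail bound uniform in the
    pair. Limits can thus be exchanged, and neither kappa nor kappa' is evaluated at t = 1 or t =
    -1. *)
Lemma kernel_limit p : SS p ->
  F p' @[p' --> within (@generic_pairs R) (nbhs p)] -->
  limn (fun n => \sum_(1 <= l < n) A l p).
Proof.
move=> Sp; rewrite limS //.
apply: (@cvg_unif_approx _ _ _ _ _ _ (fun n p' => \sum_(1 <= l < n) A l p') _
  (fun n => \sum_(1 <= l < n) A l p) (coef_tail psi)).
- move=> n; apply: filterS (withinT (@generic_pairs R) (nbhs_filter p)) => p' gp'.
  have [? ? _ _] := gp'.
  by rewrite kernel_generic // limS //; exact: S_dist.
- by move=> n; exact: partial_cvg.
- by move=> n; exact: S_dist.
- exact: coef_tail_cvg0.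
Qed.

Lemma kernel_expansion x y : S2 x -> S2 y ->
  cont_ext (@generic_pairs R) F (x, y) = limn (fun n => \sum_(1 <= l < n) A l (x, y)).
Proof.
move=> x1 y1; rewrite /cont_ext; have [|ngp] := boolP ((x, y) \in (@generic_pairs R)).
  by rewrite inE; exact: kernel_generic.
have xy : x = y \/ x = - y.
  apply: contrapT => /not_orP[xy xNy]; move/negP: ngp; apply.
  by rewrite inE.
have PF := generic_pairs_limit x1 y1 xy.
by apply: cvg_lim => //; exact: kernel_limit.
Qed.

Lemma kernel_abs_unif_cvg : abs_unif_cvg SS A.
Proof.
split=> [p Sp|].
  have -> : (fun n => \sum_(1 <= l < n) `|A l p|) = series (fun l => `|A l p|).
    by apply/funext => n; rewrite sum1_series // A0 // normr0.
  apply: series_le_cvg cb => l; [exact: normr_ge0|exact: coef_bound_ge0|].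
  by apply: mx_norm_le => [|i j]; [exact: coef_bound_ge0|exact: A_le].
apply: (@cvg_uniform_dist_le _ _ _ _ _ _ (coef_tail psi)) => [n p Sp|].
  by rewrite limS //; exact: S_dist.
exact: coef_tail_cvg0.
Qed.

End KernelExpansion.

Lemma mx_scaleE (R : pzRingType) (m n : nat) (c : R) (M : 'M[R]_(m, n)) i j :
  (c *: M) i j = c * M i j.
Proof. by rewrite mxE. Qed.

(** * Entries of the sums of vector spherical harmonics *)

Section VectorHarmonics.
Variables (R : realType) (psi : R -> R) (l : nat).
Variable Y : 'I_(2 * l + 1) -> 'cV[R]_3 -> R.
Hypothesis Y_basis : orthonormal_basis_harmonics Y.
Hypothesis Y_smooth : forall k, smooth_near_S2 (Y k).
Implicit Types x y v w : 'cV[R]_3.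

Let s : R := (Num.sqrt (l * (l + 1))%:R)^-1.

Definition harmonic_sum x v y w : R := legendre_coef psi l *
  \sum_k (s * 'D_v (Y k) x) * (s * 'D_w (Y k) y).

Lemma harmonic_sumE x v y w : harmonic_sum x v y w =
  legendre_coef psi l / (l * l.+1)%:R * \sum_k 'D_v (Y k) x * 'D_w (Y k) y.
Proof.
rewrite /harmonic_sum -mulrA; congr (_ * _); rewrite mulr_sumr.
have -> : (l * l.+1)%:R^-1 = s ^+ 2 :> R.
  by rewrite /s exprVn sqr_sqrtr // addn1.
by apply: eq_bigr => k _; ring.
Qed.

Lemma harmonic_sum_kappa x v y w : S2 x -> S2 y -> dotv x v = 0 -> dotv y w = 0 ->
  harmonic_sum x v y w = kappa'_term psi (dotv x y) l * (dotv v y * dotv x w) +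
    kappa_term psi (dotv x y) l * dotv v w.
Proof.
move=> x1 y1 xv yw; rewrite harmonic_sumE (derive_Y_both Y_basis Y_smooth) //.
rewrite /kappa'_term /kappa_term; move: (legendre_coef psi l) => c; ring.
Qed.

Lemma harmonic_sum_le x v y w : S2 x -> S2 y -> dotv x v = 0 -> dotv y w = 0 ->
  dotv v v <= 1 -> dotv w w <= 1 -> `|harmonic_sum x v y w| <= coef_bound psi l.
Proof.
move=> x1 y1 xv yw v1 w1; rewrite harmonic_sumE.
have [l0|l0] := posnP l.
  by rewrite {1 2}l0 mul0n invr0 mulr0 mul0r normr0 coef_bound_ge0.
have ll0 : 0 < (l * l.+1)%:R :> R by rewrite ltr0n muln_gt0 l0.
have B := derive_Y_bound Y_basis Y_smooth x1 y1 xv yw v1 w1.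
have b0 := coef_bound_ge0 psi l.
(* The factor l(l+1)/2 of [derive_Y_bound] against the normalization 1/(l(l+1)) leaves one half of
   the majorant. *)
apply: (@le_trans _ _ (coef_bound psi l / 2)); last by lra.
rewrite normrM [`|_ / _|]normrM [`|_^-1|]gtr0_norm ?invr_gt0 //.
apply: le_trans (ler_wpM2l _ B) _; first by rewrite mulr_ge0 // invr_ge0 ltW.
rewrite /coef_bound le_eqVlt; apply/orP; left; apply/eqP.
move: (`|_|) (_ / (4 * pi)) => c d; move: (_%:R) ll0 => e e0.
by field; rewrite gt_eqF.
Qed.

Lemma div_entry x y i j : S2 x -> S2 y ->
  (legendre_coef psi l *: \sum_k
    ((s *: surf_curl (Y k) x) *m (s *: surf_curl (Y k) y)^T)) i j =
  harmonic_sum x (curl_dir i x) y (curl_dir j y).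
Proof.
move=> x1 y1; rewrite mxE summxE; congr (_ * _); apply: eq_bigr => k _.
rewrite mxE big_ord1 [_^T _ _]mxE !mx_scaleE.
by rewrite !surf_curlE //; exact: Y_diff.
Qed.

Lemma curl_entry x y i j : S2 x -> S2 y ->
  (legendre_coef psi l *: \sum_k
    ((s *: surf_grad (Y k) x) *m (s *: surf_grad (Y k) y)^T)) i j =
  harmonic_sum x (grad_dir i x) y (grad_dir j y).
Proof.
move=> x1 y1; rewrite mxE summxE; congr (_ * _); apply: eq_bigr => k _.
rewrite mxE big_ord1 [_^T _ _]mxE !mx_scaleE.
by rewrite !surf_gradE //; exact: Y_diff.
Qed.

Lemma curl_dir_le1 i x : S2 x -> dotv (curl_dir i x) (curl_dir i x) <= 1.
Proof.
move=> x1; rewrite -matRE !mxE big_ord1 !mxE eqxx (x1 : dotv x x = 1) -expr2.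
by rewrite mulr1n gerBl sqr_ge0.
Qed.

Lemma grad_dir_le1 i x : S2 x -> dotv (grad_dir i x) (grad_dir i x) <= 1.
Proof.
move=> x1; rewrite /grad_dir -scaleNr dotvDl !dotvDr !dotvZl !dotvZr [dotv x _]dotvC.
rewrite !dotv_unitv (x1 : dotv x x = 1) mxE !eqxx.
by have := sqr_ge0 (x i 0); rewrite expr2 /=; lra.
Qed.

End VectorHarmonics.

Theorem theorem3p2 (R : realType) (psi : R -> R)
    (Y : forall l : nat, 'I_(2 * l + 1) -> 'cV[R]_3 -> R)
    (psi_cont : {within `[-1, 1], continuous psi})
    (psi_0 : legendre_coef psi 0 = 1)
    (psi_sum :
      (\sum_(1 <= l <oo) (l%:R * `|legendre_coef psi l|)%:E < +oo)%E)
    (Y_basis : forall l : nat, @orthonormal_basis_harmonics R l (Y l))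
    (Y_smooth : forall (l : nat) (k : 'I_(2 * l + 1)),
      smooth_near_S2 (Y l k)) :
  [/\ forall x y : 'cV[R]_3, S2 x -> S2 y -> x = y \/ x = - y ->
        cvg (div_formula psi @ within (@generic_pairs R) (nbhs (x, y))) /\
        cvg (curl_formula psi @ within (@generic_pairs R) (nbhs (x, y))),
      forall x y : 'cV[R]_3, S2 x -> S2 y ->
        Psi_div psi (x, y) =
          limn (fun n => \sum_(1 <= l < n) div_term psi Y l (x, y)) /\
        Psi_curl psi (x, y) =
          limn (fun n => \sum_(1 <= l < n) curl_term psi Y l (x, y)),
      abs_unif_cvg (@S2 R `*` @S2 R) (div_term psi Y) &
      abs_unif_cvg (@S2 R `*` @S2 R) (curl_term psi Y)].
Proof.
have Lb l := legendre_bounds (Y_basis l) (Y_smooth l).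
have dE l p i j : (@S2 R `*` @S2 R) p -> div_term psi Y l p i j =
    kappa'_term psi (dotv p.1 p.2) l * matQ p.1 p.2 i j +
    kappa_term psi (dotv p.1 p.2) l * matR p.1 p.2 i j.
  case=> p1 p2; rewrite /div_term /vsh_y div_entry // matQE matRE.
  by rewrite harmonic_sum_kappa //; exact: curl_dir_orth.
have cE l p i j : (@S2 R `*` @S2 R) p -> curl_term psi Y l p i j =
    kappa'_term psi (dotv p.1 p.2) l * matV p.1 p.2 i j +
    kappa_term psi (dotv p.1 p.2) l * matW p.1 p.2 i j.
  case=> p1 p2; rewrite /curl_term /vsh_z curl_entry // matVE matWE.
  by rewrite harmonic_sum_kappa //; exact: grad_dir_orth.
have dB l p i j : (@S2 R `*` @S2 R) p ->
    `|div_term psi Y l p i j| <= coef_bound psi l.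
  case=> p1 p2; rewrite /div_term /vsh_y div_entry //.
  by apply: harmonic_sum_le => //; by [exact: curl_dir_orth|exact: curl_dir_le1].
have cB l p i j : (@S2 R `*` @S2 R) p ->
    `|curl_term psi Y l p i j| <= coef_bound psi l.
  case=> p1 p2; rewrite /curl_term /vsh_z curl_entry //.
  by apply: harmonic_sum_le => //; by [exact: grad_dir_orth|exact: grad_dir_le1].
have dF p i j : div_formula psi p i j =
    derive1 (kappa psi) (dotv p.1 p.2) * matQ p.1 p.2 i j +
    kappa psi (dotv p.1 p.2) * matR p.1 p.2 i j.
  by rewrite /div_formula mxE !mx_scaleE.
have cF p i j : curl_formula psi p i j =
    derive1 (kappa psi) (dotv p.1 p.2) * matV p.1 p.2 i j +
    kappa psi (dotv p.1 p.2) * matW p.1 p.2 i j.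
  by rewrite /curl_formula mxE !mx_scaleE.
have Q := @continuous_matQ R; have T := @continuous_matR R.
have V := @continuous_matV R; have W := @continuous_matW R.
split.
(* Existence of the limits: it makes the [lim] in [cont_ext] a genuine limit and not a default
   value. *)
- move=> x y x1 y1 _; split; apply/cvg_ex; eexists.
    exact: (kernel_limit psi_cont psi_sum Lb psi_0 Q T dE dB dF (p := (x, y))).
  exact: (kernel_limit psi_cont psi_sum Lb psi_0 V W cE cB cF (p := (x, y))).
- move=> x y x1 y1; split.
    exact: (kernel_expansion psi_cont psi_sum Lb psi_0 Q T dE dB dF).
  exact: (kernel_expansion psi_cont psi_sum Lb psi_0 V W cE cB cF).
- exact: (kernel_abs_unif_cvg psi_sum dE dB).
- exact: (kernel_abs_unif_cvg psi_sum cE cB).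
Qed.
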